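(* Let $\lambda>0$, $\pi\in\mathcal M$, let $P$ be a probability distribution on $\mathcal Z$ and $Z_1,\dots,Z_n$ i.i.d. with law $P$. Let $V(g,g')=\mathbb E_{Z\sim P}\{[L(Z,g)-L(Z,g')]^2\}$. Consider the SeqRand algorithm applied with $\delta_\lambda(Z,g,g')=\lambda[L(Z,g)-L(Z,g')]^2/2$ and $\hat\pi(\rho)=\rho$, and let $\hat\mu$ be its randomizing distribution. Then $$\mathbb E_{Z_1^n}\mathbb E_{g'\sim\hat\mu}R(g')\le\min_{\rho\in\mathcal M}\Big\{\mathbb E_{g\sim\rho}R(g)+\frac\lambda2\,\mathbb E_{g\sim\rho}\mathbb E_{Z_1^n}\mathbb E_{g'\sim\hat\mu}V(g,g')+\frac{K(\rho,\pi)}{\lambda(n+1)}\Big\}.$$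
   Context: Setting: $\mathcal Z=\mathcal X\times\mathcal Y$; a prediction function is a measurable map $\mathcal X\to\mathcal Y$; $\mathcal G$ is a measurable space of prediction functions and $\mathcal M$ the set of probability distributions on $\mathcal G$. $L(z,g)\in\mathbb R$ is the loss of $g$ on $z\in\mathcal Z$ and $R(g)=\mathbb E_{Z\sim P}L(Z,g)$. All quantities are implicitly assumed measurable and the expectations well defined. $K(\rho,\pi)=\mathbb E_{g\sim\rho}\log\frac{d\rho}{d\pi}(g)$ if $\rho\ll\pi$, and $+\infty$ otherwise. For measurable $h:\mathcal G\to\mathbb R$, $\pi_{-h}(dg)=\frac{e^{-h(g)}}{\mathbb E_{g'\sim\pi}e^{-h(g')}}\pi(dg)$. SeqRand algorithm in this case: set $S_0\equiv0$, draw $\hat g_0$ from $\pi$. For $i=1,\dots,n$ define $S_i(g)=S_{i-1}(g)+L(Z_i,g)+\frac\lambda2[L(Z_i,g)-L(Z_i,\hat g_{i-1})]^2$ for $g\in\mathcal G$, and draw $\hat g_i$ from $\pi_{-\lambda S_i}$. Output a function drawn uniformly from $\{\hat g_0,\dots,\hat g_n\}$. Conditionally on $Z_1^n=(Z_1,\dots,Z_n)$, the distribution of the output function is denoted $\hat\mu$. *)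

(* Defs.v *)
From HB Require Import structures.
From mathcomp Require Import all_boot all_order all_algebra.
From mathcomp Require Import all_classical all_reals all_analysis.

Set Implicit Arguments.
Unset Strict Implicit.
Unset Printing Implicit Defensive.

Import Order.TTheory GRing.Theory Num.Theory.
Import numFieldNormedType.Exports.

Local Open Scope classical_set_scope.
Local Open Scope ring_scope.
Local Open Scope charge_scope.
Local Open Scope ereal_scope.

(* In [integral], a positive and a negative part that are both infinite give
   the junk value [+oo - +oo = -oo]; [quasi_integrable] excludes this case. *)
Definition quasi_integrable d (T : measurableType d) (R : realType)
    (mu : {measure set T -> \bar R}) (f : T -> \bar R) : Prop :=
  \int[mu]_x f^\+ x < +oo \/ \int[mu]_x f^\- x < +oo.

Definition iid d d' (Omega : measurableType d) (T : measurableType d')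
    (R : realType) (Pr : probability Omega R) (P : probability T R) (n : nat)
    (X : 'I_n -> {RV Pr >-> T}) : Prop :=
  (forall i A, measurable A -> distribution Pr (X i) A = P A) /\
  (forall (J : {set 'I_n}) (A : 'I_n -> set T),
    (forall i, measurable (A i)) ->
    Pr (\bigcap_(i in [set` J]) (X i @^-1` A i)) =
    \prod_(i in J) Pr (X i @^-1` A i)).

Definition KL d (T : measurableType d) (R : realType)
    (rho pi : probability T R) : \bar R :=
  if `[< rho `<< pi >] then
    \int[rho]_g (ln (fine (('d (charge_of_finite_measure rho) '/d pi) g)))%:E
  else +oo.

Section seqrand.
Context {dZ dG : measure_display} {Z : measurableType dZ}
  {G : measurableType dG} {R : realType}.
Implicit Types (L : Z -> G -> R) (pi : probability G R).

Definition risk (P : probability Z R) L (g : G) : \bar R :=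
  'E_P[fun z => L z g].

Definition V (P : probability Z R) L (g g' : G) : \bar R :=
  'E_P[fun z => ((L z g - L z g') ^+ 2)%R].

(* $\pi_{-h}$ *)
Definition gibbs pi (h : G -> R) (A : set G) : \bar R :=
  \int[pi]_(g in A)
    (expR (- h g) / fine ('E_pi[fun g' => expR (- h g')])%E)%:E.

(* The passage from $S_{i-1}$ to $S_i$, given $Z_i$ and $\hat g_{i-1}$. *)
Definition next_score (lam : R) L (S : G -> R) (z : Z) (ghat : G) : G -> R :=
  fun g => (S g + L z g + lam / 2 * (L z g - L z ghat) ^+ 2)%R.

(* Joint law of the successive draws of the algorithm when it is started from
   the score [S] and then fed with the data [z]: the first draw follows
   $\pi_{-\lambda S}$, and the other draws are those of the algorithm started
   from the next score and fed with the remaining data. *)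
Fixpoint draws_law (lam : R) L pi (n : nat) (S : G -> R) :
    n.-tuple Z -> set (n.+1.-tuple G) -> \bar R :=
  match n with
  | 0 => fun _ A => gibbs pi (fun g => lam * S g)%R [set g | A [tuple g]]
  | m.+1 => fun z A => \int[gibbs pi (fun g => lam * S g)%R]_g
      draws_law lam L pi (next_score lam L S (thead z) g) [tuple of behead z]
        [set t : m.+1.-tuple G | A [tuple of g :: t]]
  end.

(* $\hat\mu$ given $Z_1^n = z$; as $S_0 = 0$, the draw of $\hat g_0$ from
   $\pi$ is a draw from $\pi_{-\lambda S_0}$. *)
Definition seqrand_law (lam : R) L pi (n : nat) (z : n.-tuple Z) (A : set G) :
    \bar R :=
  (n.+1%:R^-1)%:E *
  \sum_(i < n.+1) draws_law lam L pi (cst 0%R) z [set t | A (tnth t i)].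

End seqrand.

(* Main.v *)
(* Completing the square in the score update gives, with
   D(z,g,g') = (1 + lam (L(z,g) - L(z,g')))^2 / 2 >= 0,
   that [lam * S_{i+1}] equals [lam * S_i + D(Z_{i+1}, ., ghat_i)] up to a
   constant which does not affect the Gibbs distribution; so one can work with
   nonnegative quantities only.  Since
   exp(x - x^2/2) + exp(-x - x^2/2) <= 2, symmetrizing and [ln y <= y - 1] show
   that each step increases the free energy -ln E_pi exp(-h) by at least 1/2 on
   average over the draw.  The Donsker-Varadhan inequality bounds the free
   energy after n+1 steps by E_rho h + K(rho,pi), whence
     (n+1)/2 <= (n+1) E_rho E_mub E_P D + K(rho,pi),
   where mub is the law of the output averaged over the data.  Expanding
   E_P D = 1/2 + lam (R(g) - R(g')) + lam^2/2 V(g,g') gives the bound.  The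
   right-hand side is an affine function of E_rho h + K(rho,pi) with
   h = (n+1) E_mub E_P D, which is minimized by the Gibbs distribution
   proportional to exp(-h) pi.

   If the bound is finite or -oo for some rho, then V(g,g') is finite for
   almost all pairs, and R(g) - R(g') is finite with it: either R is integrable
   for both rho and mub, or R = -oo almost everywhere for both. *)
Require Import Defs.
From HB Require Import structures.
From mathcomp Require Import all_boot all_order all_algebra.
From mathcomp Require Import all_classical all_reals all_analysis.
From mathcomp Require Import measurable_realfun ring lra.

Set Implicit Arguments.
Unset Strict Implicit.
Unset Printing Implicit Defensive.

Import Order.TTheory GRing.Theory Num.Theory.
Import numFieldNormedType.Exports.

Local Open Scope classical_set_scope.
Local Open Scope ring_scope.
Local Open Scope ereal_scope.

(** * Densities and the Kullback-Leibler divergence *)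

(** The loss has no sign and no assumed moments, so expectations of [L] and of the risk cannot at
    first be split or exchanged. Working with D postpones this: Tonelli and Donsker-Varadhan apply
    to nonnegative functions even when their integrals are infinite. The risk comes back only after
    the regret bound, under the finiteness that a right-hand side below +oo provides. The n data
    yield n+1 gains of 1/2 because the draw ghat_i depends on the first i examples only. Its
    deviation can therefore be averaged over an independent example, and for the last draw this is a
    fresh one of law P, outside the data. The constants match because D equals 1/2 at g = g': the
    gains (n+1)/2 cancel the constant term of (n+1) E_P D. *)

Section measure_probability.
Context d (T : measurableType d) (R : realType) (m : {measure set T -> \bar R}).

(** The phantom argument carries the proof of mass 1, so that instances can be attached to this
    alias of [m]. *)
Let prob_of (mT : m setT = 1) : set T -> \bar R := m.

Hypothesis mT : m setT = 1.

HB.instance Definition _ := Measure.on (prob_of mT).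

HB.instance Definition _ := Measure_isProbability.Build _ _ _ (prob_of mT) mT.

Lemma measure_probability : exists P : probability T R, forall A, P A = m A.
Proof. by exists (prob_of mT). Qed.

End measure_probability.

Section density.
Context d (T : measurableType d) (R : realType).
Implicit Types (mu nu pi rho : probability T R) (p : T -> R).

Definition has_density mu nu p := forall A, measurable A ->
  nu A = \int[mu]_(x in A) (p x)%:E.

Lemma dominates_density mu nu p :
  measurable_fun setT p -> has_density mu nu p -> nu `<< mu.
Proof.
move=> mp nup; apply/null_content_dominatesP => A mA muA0.
rewrite nup//; apply: null_set_integral => //.
exact/measurable_EFinP/measurable_funTS.
Qed.

(** The change of variables holds for the Radon-Nikodym derivative, and [p] equals it [mu]-a.e.
    because both integrate to [nu A] over every measurable [A]. *)
Lemma ge0_integral_density mu nu p (f : T -> \bar R) :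
    measurable_fun setT p -> (forall x, 0 <= p x)%R -> has_density mu nu p ->
    measurable_fun setT f -> (forall x, 0 <= f x) ->
  \int[nu]_x f x = \int[mu]_x (f x * (p x)%:E).
Proof.
move=> mp p0 nup mf f0.
have numu := dominates_density mp nup.
pose q := Radon_Nikodym_SigmaFinite.f nu mu.
have qp : ae_eq mu setT q (EFin \o p).
  apply: integral_ae_eq => //.
  - exact: Radon_Nikodym_SigmaFinite.f_integrable.
  - exact/measurable_EFinP.
  - move=> A _ mA.
    by rewrite -(Radon_Nikodym_SigmaFinite.f_integral numu mA); exact: nup.
have mq : measurable_fun setT q.
  exact: measurable_int (Radon_Nikodym_SigmaFinite.f_integrable numu).
rewrite -(Radon_Nikodym_SigmaFinite.change_of_variables numu)//.
apply: ge0_ae_eq_integral => //.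
- exact: emeasurable_funM.
- by apply: emeasurable_funM => //; exact/measurable_EFinP.
- by move=> x _; rewrite mule_ge0// Radon_Nikodym_SigmaFinite.f_ge0.
- by move=> x _; rewrite mule_ge0// lee_fin.
- exact: ae_eqe_mul2l.
Qed.

Lemma density_probability mu p :
    measurable_fun setT p -> (forall x, 0 <= p x)%R ->
    \int[mu]_x (p x)%:E = 1 ->
  exists nu : probability T R, forall A, nu A = \int[mu]_(x in A) (p x)%:E.
Proof.
move=> mp p0 p1.
pose m A := \int[mu]_(x in A) (p x)%:E.
have m0 : m set0 = 0 by rewrite /m integral_set0.
have m_ge0 A : 0 <= m A by apply: integral_ge0 => x _; rewrite lee_fin.
have ms : semi_sigma_additive m.
  move=> F mF tF mUF; rewrite /m ge0_integral_bigcup//.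
  - apply: is_cvg_nneseries => n _ _.
    by apply: integral_ge0 => x _; rewrite lee_fin.
  - by apply/measurable_EFinP; exact: measurable_funTS.
  - by move=> x _; rewrite lee_fin.
pose mm := isMeasure.Build _ _ _ m m0 m_ge0 ms.
pose m' : {measure set T -> \bar R} := HB.pack m mm.
have [nu nuE] := @measure_probability _ _ _ m' p1.
by exists nu => A; rewrite nuE.
Qed.

Lemma Radon_Nikodym_density pi rho : rho `<< pi -> exists p,
  [/\ measurable_fun setT p, (forall x, 0 <= p x)%R & has_density pi rho p].
Proof.
move=> rhopi; pose q := Radon_Nikodym_SigmaFinite.f rho pi.
have qE x : (fine (q x))%:E = q x.
  by rewrite fineK// Radon_Nikodym_SigmaFinite.f_fin_num.
exists (fine \o q); split.
- apply: measurableT_comp => //.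
  exact: measurable_int (Radon_Nikodym_SigmaFinite.f_integrable rhopi).
- by move=> x; rewrite /= fine_ge0// Radon_Nikodym_SigmaFinite.f_ge0.
- move=> A mA; rewrite (Radon_Nikodym_SigmaFinite.f_integral rhopi mA).
  by apply: eq_integral => x _ /=; rewrite qE.
Qed.

(** Two densities differ on a [pi]-null set only, which is [rho]-null by domination. *)
Lemma KL_density pi rho p :
    measurable_fun setT p -> (forall x, 0 <= p x)%R -> has_density pi rho p ->
  KL rho pi = \int[rho]_x (ln (p x))%:E.
Proof.
move=> mp p0 rhop; have rhopi := dominates_density mp rhop.
rewrite /KL asboolT//.
set q := Radon_Nikodym _ _.
have qp : ae_eq pi setT q (EFin \o p).
  apply: integral_ae_eq => //.
  - exact: Radon_Nikodym_integrable.
  - exact/measurable_EFinP.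
  - by move=> A _ mA; rewrite -Radon_Nikodym_integral//= rhop.
have mq : measurable_fun setT q.
  exact: measurable_int (Radon_Nikodym_integrable _).
apply: ae_eq_integral => //.
- apply/measurable_EFinP; apply: measurableT_comp => //.
  exact: measurableT_comp.
- by apply/measurable_EFinP; exact: measurableT_comp.
- apply: filterS (null_dominates_ae_eq _ rhopi qp) => // x /= qpx _.
  by rewrite qpx.
Qed.

(** [ln] has a default value at 0; this confines all arguments about [ln (p x)] to points where it
    is a true logarithm. *)
Lemma density_gt0_ae pi rho p :
    measurable_fun setT p -> (forall x, 0 <= p x)%R -> has_density pi rho p ->
  {ae rho, forall x, (0 < p x)%R}.
Proof.
move=> mp p0 rhop.
have mN : measurable (p @^-1` [set 0%R]).
  by rewrite -[X in measurable X]setTI; exact: mp.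
exists (p @^-1` [set 0%R]); split => //.
  rewrite /= rhop// (eq_integral (cst 0)) ?integral0// => x.
  by rewrite inE => /= ->.
by move=> x /= /negP; rewrite lt_neqAle p0 andbT negbK => /eqP.
Qed.

End density.

Lemma ln_le_sub1 (R : realType) (x : R) : (0 < x)%R -> (ln x <= x - 1)%R.
Proof.
move=> x0; have -> : x = (1 + (x - 1))%R by lra.
by apply: (le_trans (le_ln1Dx _)); lra.
Qed.

Lemma integral_prob_cst d (T : measurableType d) (R : realType)
  (P : probability T R) (c : \bar R) : \int[P]_x c = c.
Proof.
rewrite integral_cst// [X in _ * X](_ : _ = 1) ?mule1//.
exact: probability_setT.
Qed.

(** * The Gibbs variational principle *)

Section donsker_varadhan.
Context d (T : measurableType d) (R : realType).
Implicit Types (pi rho : probability T R) (h : T -> \bar R).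

(** [h] is extended-valued because the oracle deviation can be infinite; the value 0 is then
    exp(-oo). *)
Definition boltzmann h x : R := if h x is r%:E then expR (- r) else 0%R.

Definition partition_fun pi h : R := fine (\int[pi]_x (boltzmann h x)%:E).

Lemma boltzmann_ge0 h x : (0 <= boltzmann h x)%R.
Proof. by rewrite /boltzmann; case: (h x) => // r; exact: expR_ge0. Qed.

Lemma boltzmann_le1 h x : 0 <= h x -> (boltzmann h x <= 1)%R.
Proof.
rewrite /boltzmann; case: (h x) => [r|_|//] /=; last by [].
by rewrite lee_fin => r0; rewrite expR_le1 oppr_le0.
Qed.

(** From [r <= 1 + r <= expR r]. It makes the mean of [h] under its own Gibbs law finite. *)
Lemma mule_boltzmann_le1 h x : 0 <= h x -> h x * (boltzmann h x)%:E <= 1.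
Proof.
rewrite /boltzmann; case: (h x) => [r|_|//] /=; last by rewrite mule0.
rewrite !lee_fin => r0; rewrite expRN ler_pdivrMr ?expR_gt0// mul1r.
by rewrite (le_trans _ (expR_ge1Dx r))// lerDr.
Qed.

Lemma measurable_boltzmann h :
  measurable_fun setT h -> measurable_fun setT (boltzmann h).
Proof.
move=> mh; have -> : boltzmann h =
    fun x => if h x \is a fin_num then expR (- fine (h x)) else 0%R.
  by apply/funext => x; rewrite /boltzmann; case: (h x).
apply: measurable_fun_ifT => //.
  by apply: (measurable_fun_bool true); exact: emeasurable_fin_num.
apply: measurableT_comp => //; apply: measurableT_comp => //.
exact: measurableT_comp.
Qed.

Lemma partition_funE pi h : measurable_fun setT h -> (forall x, 0 <= h x) ->
  (partition_fun pi h)%:E = \int[pi]_x (boltzmann h x)%:E.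
Proof.
move=> mh h0; rewrite fineK// ge0_fin_numE; last first.
  by apply: integral_ge0 => x _; rewrite lee_fin boltzmann_ge0.
apply: (@le_lt_trans _ _ (\int[pi]_x 1)); last first.
  by rewrite integral_prob_cst ltry.
apply: ge0_le_integral => //.
- by move=> x _; rewrite lee_fin boltzmann_ge0.
- by apply/measurable_EFinP; exact: measurable_boltzmann.
- by move=> x _; rewrite lee_fin boltzmann_le1.
Qed.

Lemma partition_fun_le1 pi h : measurable_fun setT h -> (forall x, 0 <= h x) ->
  (partition_fun pi h <= 1)%R.
Proof.
move=> mh h0; rewrite -lee_fin partition_funE//.
rewrite [leRHS](_ : _ = \int[pi]_x 1); last first.
  by rewrite integral_prob_cst.
apply: ge0_le_integral => //.
- by move=> x _; rewrite lee_fin boltzmann_ge0.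
- by apply/measurable_EFinP; exact: measurable_boltzmann.
- by move=> x _; rewrite lee_fin boltzmann_le1.
Qed.

(** Meant for [u] proportional to [1 / p]: the factor [p] cancels where it is positive, while
    [u * p] vanishes elsewhere, whence an inequality. *)
Lemma integral_inv_density_le1 pi rho (p u v : T -> R) :
    measurable_fun setT p -> (forall x, 0 <= p x)%R -> has_density pi rho p ->
    measurable_fun setT u -> (forall x, 0 <= u x)%R ->
    measurable_fun setT v -> (forall x, 0 <= v x)%R ->
    (forall x, u x * p x <= v x)%R ->
  \int[rho]_x (u x)%:E <= \int[pi]_x (v x)%:E.
Proof.
move=> mp p0 rhop mu u0 mv v0 upv.
rewrite (ge0_integral_density mp p0 rhop)//; last first.
  exact/measurable_EFinP.
apply: ge0_le_integral => //.
- by move=> x _; rewrite mule_ge0 ?lee_fin.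
- by apply/measurable_EFinP; exact: measurable_funM.
- exact/measurable_EFinP.
- by move=> x _; rewrite lee_fin.
Qed.

(** Obtained by integrating [ln u <= u - 1] for the likelihood ratio [u] of the Gibbs law to [rho].
    No finiteness of the mean of [h] or of the divergence is assumed. *)
Lemma donsker_varadhan pi rho h :
    measurable_fun setT h -> (forall x, 0 <= h x) ->
    (0 < partition_fun pi h)%R ->
  (- ln (partition_fun pi h))%:E <= \int[rho]_x h x + KL rho pi.
Proof.
move=> mh h0; set W := partition_fun pi h => W0.
have W1 : (W <= 1)%R by exact: partition_fun_le1.
have inth0 : 0 <= \int[rho]_x h x by exact: integral_ge0.
have [rhopi|nrhopi] := pselect (rho `<< pi); last first.
  by rewrite /KL asboolF// addey ?leey// gt_eqF// (lt_le_trans _ inth0).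
have [p [mp p0 rhop]] := Radon_Nikodym_density rhopi.
rewrite (KL_density mp p0 rhop).
pose l x := (ln (p x))%:E.
have ml : measurable_fun setT l.
  by apply/measurable_EFinP; exact: measurableT_comp.
have mpV : measurable_fun setT (fun x => (p x)^-1)%R.
  rewrite (_ : (fun _ => _) = (fun x => powR (p x) (-1))); last first.
    by apply/funext => x; rewrite powR_inv1.
  exact: measurableT_comp (measurable_powR _) mp.
(* The Gibbs density over the density of [rho]; its [rho]-mass is at most 1, less if [rho] misses
   part of the Gibbs law. *)
pose u x := (boltzmann h x / W * (p x)^-1)%R.
have mu : measurable_fun setT u.
  apply: measurable_funM => //; apply: measurable_funM => //.
  exact: measurable_boltzmann.
have u0 x : (0 <= u x)%R.
  by rewrite !mulr_ge0 ?invr_ge0 ?boltzmann_ge0// ltW.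
have intu : \int[rho]_x (u x)%:E <= 1.
  apply: (le_trans (@integral_inv_density_le1 pi rho p u
      (fun x => W^-1 * boltzmann h x)%R _ _ _ _ _ _ _ _)) => //.
  - by apply: measurable_funM => //; exact: measurable_boltzmann.
  - by move=> x; rewrite mulr_ge0 ?invr_ge0 ?boltzmann_ge0 ?ltW.
  - move=> x; have [->|px0] := eqVneq (p x) 0%R.
      by rewrite mulr0 mulr_ge0 ?invr_ge0 ?boltzmann_ge0 ?ltW.
    by rewrite /u mulfVK// mulrC.
  under eq_integral do rewrite EFinM.
  rewrite ge0_integralZl//; last 3 first.
  - by apply/measurable_EFinP; exact: measurable_boltzmann.
  - by move=> x _; rewrite lee_fin boltzmann_ge0.
  - by rewrite lee_fin invr_ge0 ltW.
  by rewrite -partition_funE// -EFinM mulVf ?gt_eqF.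
(* Since [- ln p = ln (1 / p) <= 1 / p], the negative part of [ln p] is always integrable, so the
   divergence is never an undefined difference. *)
have intln : \int[rho]_x l^\- x <= 1.
  apply: (@le_trans _ _ (\int[rho]_x (p x)^-1%:E)).
    apply: ae_ge0_le_integral => //.
    - exact: measurable_funeneg.
    - by move=> x _; rewrite lee_fin invr_ge0.
    - exact/measurable_EFinP.
    apply: filterS (density_gt0_ae mp p0 rhop) => x px0 _.
    rewrite funenegE /l -EFinN -EFin_max lee_fin ge_max invr_ge0 p0 andbT.
    rewrite -lnV ?posrE// (le_trans (ln_le_sub1 _)) ?invr_gt0//.
    by rewrite gerBl.
  apply: (le_trans (@integral_inv_density_le1 pi rho p _
      (fun x => 1)%R _ _ _ _ _ _ _ _)) => //.
  - by move=> x; rewrite invr_ge0.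
  - move=> x; have [->|px0] := eqVneq (p x) 0%R; first by rewrite mulr0.
    by rewrite mulVf.
  by rewrite integral_prob_cst.
(* This is [ln u <= u - 1] with each term moved to the side where it is nonnegative. *)
have key : 1 + \int[rho]_x l^\- x + (- ln W)%:E <=
    \int[rho]_x h x + \int[rho]_x l^\+ x + \int[rho]_x (u x)%:E.
  have mh1 : measurable_fun setT (fun x => h x + l^\+ x).
    by apply: emeasurable_funD => //; exact: measurable_funepos.
  rewrite -[1](integral_prob_cst rho) -[(- ln W)%:E](integral_prob_cst rho).
  rewrite -!ge0_integralD//.
  2: by move=> x _; rewrite adde_ge0.
  2: by move=> x _; rewrite lee_fin.
  2: exact/measurable_EFinP.
  2: exact: measurable_funepos.
  2: by move=> x _; rewrite adde_ge0.
  2: by apply: emeasurable_funD => //; exact: measurable_funeneg.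
  2: by move=> x _; rewrite lee_fin oppr_ge0 ln_le0.
  2: exact: measurable_funeneg.
  apply: ae_ge0_le_integral => //.
  - by move=> x _; rewrite !adde_ge0// lee_fin oppr_ge0 ln_le0.
  - apply: emeasurable_funD => //; apply: emeasurable_funD => //.
    exact: measurable_funeneg.
  - by move=> x _; rewrite !adde_ge0// lee_fin.
  - by apply: emeasurable_funD => //; exact/measurable_EFinP.
  apply: filterS (density_gt0_ae mp p0 rhop) => x px0 _.
  rewrite /u /boltzmann funenegE funeposE /l -EFinN -!EFin_max.
  have := h0 x; case: (h x) => [r r0|_|//]; last by rewrite leey.
  rewrite -!EFinD lee_fin.
  have ur0 : (0 < expR (- r) / W / p x)%R.
    by rewrite !divr_gt0// expR_gt0.
  have := ln_le_sub1 ur0.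
  rewrite !ln_div ?posrE ?divr_gt0 ?expR_gt0// expRK.
  by case: (leP (ln (p x)) 0%R); case: (leP (- ln (p x))%R 0%R); lra.
rewrite [X in _ + X]integralE -/l.
have In0 : 0 <= \int[rho]_x l^\- x by exact: integral_ge0.
have Inf : \int[rho]_x l^\- x \is a fin_num.
  by rewrite ge0_fin_numE// (le_lt_trans intln)// ltry.
rewrite addeA leeBrDr//.
rewrite -(@leeD2lE _ 1)// addeCA [leLHS]addeC [leRHS]addeC (le_trans key)//.
exact: leeD2l.
Qed.

(** The equality case, at the law of density [boltzmann h / W], where [ln p = - h - ln W]. *)
Lemma donsker_varadhan_eq pi h :
    measurable_fun setT h -> (forall x, 0 <= h x) ->
    (0 < partition_fun pi h)%R ->
  exists rho : probability T R, [/\ \int[rho]_x h x < +oo,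
    KL rho pi \is a fin_num &
    \int[rho]_x h x + KL rho pi = (- ln (partition_fun pi h))%:E].
Proof.
move=> mh h0; set W := partition_fun pi h => W0.
pose p x := (boltzmann h x / W)%R.
have mb := measurable_boltzmann mh.
have mp : measurable_fun setT p by exact: measurable_funM.
have p0 x : (0 <= p x)%R by rewrite divr_ge0 ?boltzmann_ge0 ?ltW.
have intp : \int[pi]_x (p x)%:E = 1.
  under eq_integral do rewrite EFinM.
  rewrite ge0_integralZr//.
  - by rewrite -partition_funE// -EFinM divff// gt_eqF.
  - exact/measurable_EFinP.
  - by move=> x _; rewrite lee_fin boltzmann_ge0.
  - by rewrite lee_fin invr_ge0 ltW.
have [rho rhop] := density_probability mp p0 intp.
have {}rhop : has_density pi rho p by move=> A _; exact: rhop.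
exists rho.
have inth0 : 0 <= \int[rho]_x h x by exact: integral_ge0.
have inth : \int[rho]_x h x < +oo.
  rewrite (ge0_integral_density mp p0 rhop)//.
  apply: (@le_lt_trans _ _ (\int[pi]_x (W^-1)%:E)); last first.
    by rewrite integral_prob_cst ltry.
  apply: ge0_le_integral => //.
  - by move=> x _; rewrite mule_ge0// lee_fin.
  - by apply: emeasurable_funM => //; exact/measurable_EFinP.
  move=> x _; rewrite /p EFinM muleA -[leRHS]mul1e.
  apply: lee_wpmul2r; first by rewrite lee_fin invr_ge0 ltW.
  exact: mule_boltzmann_le1.
have ih : rho.-integrable setT h.
  apply/integrableP; split => //.
  by under eq_integral do rewrite gee0_abs//.
have hfin : \int[rho]_x h x \is a fin_num by rewrite ge0_fin_numE.
have KLE : KL rho pi = - (\int[rho]_x h x) - (ln W)%:E.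
  rewrite (KL_density mp p0 rhop).
  transitivity (\int[rho]_x (- h x - (ln W)%:E)).
    apply: ae_eq_integral => //.
    - by apply/measurable_EFinP; exact: measurableT_comp.
    - by apply: emeasurable_funB => //; exact: measurableT_comp.
    apply: filterS (density_gt0_ae mp p0 rhop) => x + _.
    rewrite /p /boltzmann; case: (h x) (h0 x) => [r _ _|_|//].
      by rewrite ln_div ?posrE ?expR_gt0// expRK EFinB.
    (* Where [h] is [+oo] the density is 0, against its positivity. *)
    by rewrite mul0r ltxx.
  rewrite integralB//.
  - by rewrite [X in _ - X]integral_prob_cst integral_ge0N.
  - exact: integrableN.
  - exact: finite_measure_integrable_cst.
split => //.
- by rewrite KLE fin_numB fin_numN hfin.
- by rewrite KLE addeA subee// add0e EFinN.
Qed.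

(** Donsker-Varadhan at [h = 0], whose partition function is 1. *)
Lemma KL_ge0 pi rho : 0 <= KL rho pi.
Proof.
have W1 : partition_fun pi (cst 0) = 1%R.
  rewrite /partition_fun /boltzmann/= oppr0 expR0.
  by rewrite integral_prob_cst.
have := @donsker_varadhan pi rho (cst 0) (measurable_cst _) (fun=> lexx _).
by rewrite W1 ln1 oppr0 integral0 add0e; apply.
Qed.

End donsker_varadhan.
(** * The variance inequality *)

(** Equivalent to cosh x <= exp(x^2/2). For [t >= 0] the left-hand side [f] decreases: its
    derivative is a negative multiple of [k], and [k 0 = 0] with [k] increasing. *)
Lemma expR_sym_le (R : realType) (x : R) :
  (expR (x - x ^+ 2 / 2) + expR (- x - x ^+ 2 / 2) <= 2)%R.
Proof.
wlog x0 : x / (0 <= x)%R.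
  move=> H; have [/H//|/ltW x0] := leP 0%R x.
  by have := H (- x)%R; rewrite oppr_ge0 sqrrN opprK addrC; apply.
pose f (t : R) := (expR (t - t ^+ 2 / 2) + expR (- t - t ^+ 2 / 2))%R.
pose k (t : R) := (t * (expR t + expR (- t)) - (expR t - expR (- t)))%R.
have dk (t : R) : is_derive t 1%R k (t * (expR t - expR (- t)))%R.
  rewrite /k; apply: is_derive_eq; rewrite /GRing.scale/=; ring.
have df (t : R) : is_derive t 1%R f (- (expR (- (t ^+ 2 / 2)) * k t))%R.
  rewrite /f; apply: is_derive_eq; rewrite /GRing.scale/= /k !expRD.
  by field.
have mono (q dq : R -> R) : (forall t : R, is_derive t 1%R q (dq t)) ->
    (forall t, 0 <= t -> 0 <= dq t)%R ->
    forall t : R, (0 <= t)%R -> (q 0 <= q t)%R.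
  move=> qdq dq0 t t0; rewrite -subr_ge0.
  have [c|c] := @MVT_segment _ q dq 0%R t t0 (fun z _ => qdq z).
    by apply: derivable_within_continuous => z _; exact: ex_derive.
  rewrite in_itv/= => /andP[c0 _] ->; rewrite subr0.
  by rewrite mulr_ge0// dq0.
have k0 t : (0 <= t)%R -> (0 <= k t)%R.
  move=> t0; have -> : 0%R = k 0%R by rewrite /k oppr0; ring.
  apply: (mono _ _ dk) t0 => s s0; rewrite mulr_ge0// subr_ge0 ler_expR.
  by lra.
have : (f x <= f 0)%R.
  rewrite -lerN2; apply: (mono (fun t => - f t)%R _ _ _ _ x0) => t t0.
  by rewrite opprK mulr_ge0 ?expR_ge0// k0.
rewrite /f => /le_trans; apply.
by rewrite expr0n/= mul0r oppr0 addr0 expR0; lra.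
Qed.

Section variance_step.
Context d (T : measurableType d) (R : realType).
Variables (pi : probability T R) (x : T -> R) (mx : measurable_fun setT x).

(** With [d = a - b], [1 / 2 - deviation a b] is [- d - d ^+ 2 / 2], an exponent of [expR_sym_le].
    The factor [lam] will sit inside [a] and [b]. *)
Definition deviation (a b : R) : R := ((1 + (a - b)) ^+ 2 / 2)%R.

Lemma deviation_ge0 a b : (0 <= deviation a b)%R.
Proof. by rewrite divr_ge0// sqr_ge0. Qed.

Lemma expR_deviation_sym a b :
  (expR (1 / 2 - deviation a b) + expR (1 / 2 - deviation b a) <= 2)%R.
Proof.
have := @expR_sym_le _ (b - a); rewrite /deviation.
by congr (expR _ + expR _ <= _)%R; field.
Qed.

(** Both variables have law [gam], so twice the integral is that of the integrand plus its
    transpose, which is at most 2 pointwise. *)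
Lemma integral_deviation_le1 (gam : probability T R) :
  \int[gam]_b \int[gam]_a (expR (1 / 2 - deviation (x a) (x b)))%:E <= 1.
Proof.
pose F (ab : T * T) := (expR (1 / 2 - deviation (x ab.1) (x ab.2)))%:E.
have mF : measurable_fun setT F.
  apply/measurable_EFinP; apply: measurableT_comp => //.
  apply: measurable_funB => //; apply: measurable_funM => //.
  apply: measurable_funX; apply: measurable_funD => //.
  by apply: measurable_funB; exact: measurableT_comp.
have F0 ab : 0 <= F ab by rewrite lee_fin expR_ge0.
pose F' (ab : T * T) := F (ab.2, ab.1).
have mF' : measurable_fun setT F'.
  apply: (measurableT_comp mF); exact/measurable_fun_pair.
have E1 : \int[(gam \x gam)%E]_z F z = \int[gam]_b \int[gam]_a F (a, b).
  exact: fubini_tonelli2.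
have E2 : \int[(gam \x gam)%E]_z F' z = \int[gam]_b \int[gam]_a F (a, b).
  transitivity (\int[gam]_b \int[gam]_a F' (b, a)); last by [].
  by apply: fubini_tonelli1 => // ab; exact: F0.
have I0 : 0 <= \int[gam]_b \int[gam]_a F (a, b).
  by apply: integral_ge0 => b _; apply: integral_ge0.
rewrite -(@lee_pmul2l _ 2%:E)// mule1 mule_natl mule2n.
rewrite -[X in X + _]E1 -[X in _ + X]E2 -ge0_integralD//; last first.
  by move=> ab _; exact: F0.
rewrite -[leRHS](integral_prob_cst (gam \x gam)%E).
apply: ge0_le_integral => //.
- by move=> ab _; rewrite adde_ge0// F0.
- exact: emeasurable_funD.
- by move=> ab _; rewrite lee_fin expR_deviation_sym.
Qed.

(** A zero integral would force the exponential to vanish almost everywhere, which a finite [f]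
    excludes. *)
Lemma partition_fun_gt0 (f : T -> R) : measurable_fun setT f ->
  (forall g, 0 <= f g)%R -> (0 < partition_fun pi (EFin \o f))%R.
Proof.
move=> mf f0; rewrite -lte_fin partition_funE//; last exact/measurable_EFinP.
rewrite lt_neqAle; apply/andP; split; last first.
  by apply: integral_ge0 => g _; rewrite lee_fin boltzmann_ge0.
apply/eqP => /esym.
have mb : measurable_fun setT (fun g => (boltzmann (EFin \o f) g)%:E).
  apply/measurable_EFinP; apply: measurable_boltzmann.
  exact/measurable_EFinP.
under eq_integral do rewrite -[_%:E]gee0_abs ?lee_fin ?boltzmann_ge0//.
move/(ae_eq_integral_abs pi measurableT mb)=> [N [mN N0 sub]].
have : pi setT <= pi N.
  apply: le_measure; rewrite ?inE// => g _; apply: sub => /= /(_ Logic.I).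
  by rewrite /boltzmann/= => -[] /eqP; rewrite expR_eq0.
by rewrite N0 probability_setT lee_fin ler10.
Qed.


Definition free_energy (f : T -> R) : R := - ln (partition_fun pi (EFin \o f)).

Lemma free_energy_ge0 (f : T -> R) : measurable_fun setT f ->
  (forall g, 0 <= f g)%R -> (0 <= free_energy f)%R.
Proof.
move=> mf f0; rewrite oppr_ge0 ln_le0// partition_fun_le1//.
exact/measurable_EFinP.
Qed.

Lemma measurable_deviation : measurable_fun setT
  (fun ab : T * T => deviation (x ab.1) (x ab.2)).
Proof.
apply: measurable_funM => //; apply: measurable_funX.
apply: measurable_funD => //; apply: measurable_funB.
  exact: measurableT_comp mx measurable_fst.
exact: measurableT_comp mx measurable_snd.
Qed.

Lemma measurable_deviationl b :
  measurable_fun setT (fun a => deviation (x a) (x b)).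
Proof.
apply: measurable_funM => //; apply: measurable_funX.
by apply: measurable_funD => //; exact: measurable_funB.
Qed.

Variables (h : T -> R) (mh : measurable_fun setT h)
  (h0 : forall g, (0 <= h g)%R).

Let W b := partition_fun pi (EFin \o (fun a => h a + deviation (x a) (x b)))%R.

Let mhD b : measurable_fun setT (fun a => h a + deviation (x a) (x b))%R.
Proof.
by apply: measurable_funD => //; exact: measurable_deviationl.
Qed.

Let hD0 b a : (0 <= h a + deviation (x a) (x b))%R.
Proof. by rewrite addr_ge0// deviation_ge0. Qed.

Lemma measurable_free_energy_deviation : measurable_fun setT
  (fun b => free_energy (fun a => h a + deviation (x a) (x b))%R).
Proof.
apply: measurableT_comp => //; apply: measurableT_comp => //.
apply: measurableT_comp => //.
apply: (@measurable_fun_fubini_tonelli_G _ _ _ _ _ pi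
  (fun ab => (expR (- (h ab.1 + deviation (x ab.1) (x ab.2))))%:E)).
- apply/measurable_EFinP; apply: measurableT_comp => //.
  apply: measurableT_comp => //; apply: measurable_funD.
    exact: measurableT_comp mh measurable_fst.
  exact: measurable_deviation.
- by move=> ab; rewrite lee_fin expR_ge0.
Qed.

Lemma variance_step (gam : probability T R) :
    has_density pi gam
      (fun a => expR (- h a) / partition_fun pi (EFin \o h))%R ->
  (free_energy h + 1 / 2)%:E <=
  \int[gam]_b (free_energy (fun a => h a + deviation (x a) (x b))%R)%:E.
Proof.
set W0 := partition_fun pi (EFin \o h) => gamE.
have W0_gt0 : (0 < W0)%R by exact: partition_fun_gt0.
(* Integrating exp(-D) against the Gibbs law of [h] gives the ratio of the new partition function to
   the old one. *)
have WE b : \int[gam]_a (expR (1 / 2 - deviation (x a) (x b)))%:E =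
    (expR (1 / 2) * (W b / W0))%:E.
  rewrite (ge0_integral_density _ _ gamE)//; last 3 first.
  - apply: measurable_funM => //; apply: measurableT_comp => //.
    exact: measurableT_comp.
  - by move=> a; rewrite divr_ge0 ?expR_ge0 ?ltW.
  - apply/measurable_EFinP; apply: measurableT_comp => //.
    by apply: measurable_funB => //; exact: measurable_deviationl.
  transitivity (\int[pi]_a ((expR (1 / 2) / W0)%:E *
     (boltzmann (EFin \o (fun a => h a + deviation (x a) (x b))%R) a)%:E)).
    apply: eq_integral => a _; rewrite /boltzmann/= -!EFinM; congr EFin.
    by rewrite opprD !expRD; ring.
  rewrite ge0_integralZl//.
  - rewrite -partition_funE; last 2 first.
    + exact/measurable_EFinP.
    + by move=> a; rewrite lee_fin.
    by rewrite -EFinM /W; congr EFin; ring.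
  - apply/measurable_EFinP; apply: measurable_boltzmann.
    exact/measurable_EFinP.
  - by move=> a _; rewrite lee_fin boltzmann_ge0.
  - by rewrite lee_fin divr_ge0 ?expR_ge0 ?ltW.
have Wb_gt0 b : (0 < W b)%R by exact: partition_fun_gt0.
have := integral_deviation_le1 gam.
under eq_integral do rewrite WE.
set Y := (X in X <= 1) => Y1.
(* Adding 1 on both sides and then replacing it by [Y <= 1] on the right keeps all integrands
   nonnegative, with no difference of integrals. *)
rewrite -(@leeD2rE _ 1)// -EFinD.
apply: (@le_trans _ _ (\int[gam]_b
   (free_energy (fun a => h a + deviation (x a) (x b))%R)%:E + Y)); last first.
  exact: leeD2l.
have mFE := measurable_free_energy_deviation.
have mY : measurable_fun setT (fun b => (expR (1 / 2) * (W b / W0))%:E).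
  under eq_fun do rewrite -WE.
  apply: (@measurable_fun_fubini_tonelli_G _ _ _ _ _ gam
     (fun ab => (expR (1 / 2 - deviation (x ab.1) (x ab.2)))%:E)).
  - apply/measurable_EFinP; apply: measurableT_comp => //.
    by apply: measurable_funB => //; exact: measurable_deviation.
  - by move=> ab; rewrite lee_fin expR_ge0.
have FE0 b : (0 <= free_energy (fun a => h a + deviation (x a) (x b)))%R.
  exact: free_energy_ge0.
have Y0 b : (0 <= expR (1 / 2) * (W b / W0))%R.
  by rewrite mulr_ge0 ?expR_ge0// divr_ge0// ltW.
rewrite /Y -ge0_integralD//; last 3 first.
- by move=> b _; rewrite lee_fin.
- exact/measurable_EFinP.
- by move=> b _; rewrite lee_fin.
rewrite -[leLHS](integral_prob_cst gam).
apply: ge0_le_integral => //.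
- by move=> b _; rewrite lee_fin !addr_ge0// free_energy_ge0.
- by apply: emeasurable_funD => //; exact/measurable_EFinP.
move=> b _; rewrite -EFinD lee_fin /free_energy -/(W b) -/W0.
have y_gt0 : (0 < expR (1 / 2) * (W b / W0))%R.
  by rewrite mulr_gt0 ?expR_gt0// divr_gt0.
(* [ln y <= y - 1] at [y = sqrt e * W b / W0]: the average of [y] over [b] is
   at most 1, so [- ln (W b / W0)] is at least 1/2 on average. *)
have := ln_le_sub1 y_gt0.
rewrite lnM ?posrE ?expR_gt0 ?divr_gt0// expRK ln_div ?posrE//.
move: (ln _) (ln _) (expR _ * _)%R => l0 lb y; lra.
Qed.

End variance_step.
(** * Gibbs posteriors as kernels *)

Section kernel_of_probability.
Context d d' (T : measurableType d) (U : measurableType d') (R : realType).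
Variable k : T -> probability U R.

(** As for [prob_of], the measurability proof is an argument so that the kernel instances can depend
    on it. *)
Definition kernel_of
    (mk : forall A, measurable A -> measurable_fun setT (fun t => k t A))
    (t : T) : {measure set U -> \bar R} := k t.

Hypothesis mk : forall A, measurable A -> measurable_fun setT (fun t => k t A).

HB.instance Definition _ :=
  isKernel.Build _ _ _ _ _ (kernel_of mk) mk.

HB.instance Definition _ :=
  Kernel_isProbability.Build _ _ _ _ _ (kernel_of mk)
    (fun t => probability_setT (k t)).

End kernel_of_probability.

Section gibbs_theory.
Context d (G : measurableType d) (R : realType) (pi : probability G R).
Implicit Types h : G -> R.

(** Scores may be negative; a lower bound is what keeps exp(-h) integrable and makes [gibbs] a
    probability. *)
Definition bounded_below h := exists c, forall g, (c <= h g)%R.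

Lemma gibbs_ge0E h A : measurable_fun setT h -> (forall g, 0 <= h g)%R ->
  gibbs pi h A =
  \int[pi]_(g in A) (expR (- h g) / partition_fun pi (EFin \o h))%:E.
Proof. by move=> mh h0; rewrite /gibbs unlock. Qed.

Lemma gibbs_shift h c : measurable_fun setT h -> (forall g, 0 <= h g)%R ->
  gibbs pi (fun g => h g + c)%R = gibbs pi h.
Proof.
move=> mh h0; apply/funext => A; rewrite (gibbs_ge0E _ mh h0) /gibbs.
set W := partition_fun _ _.
have -> : 'E_pi[fun g' => expR (- (h g' + c))] = (expR (- c) * W)%:E.
  rewrite unlock EFinM /W partition_funE//; last exact/measurable_EFinP.
  - rewrite -ge0_integralZl//.
    + apply: eq_integral => g _.
      by rewrite -EFinM /boltzmann/= opprD expRD mulrC.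
    + apply/measurable_EFinP; apply: measurable_boltzmann.
      exact/measurable_EFinP.
    + by move=> g _; rewrite lee_fin boltzmann_ge0.
have W_gt0 : (0 < W)%R by exact: partition_fun_gt0.
apply: eq_integral => g _; congr EFin; rewrite opprD expRD/=.
by field; rewrite !gt_eqF ?expR_gt0.
Qed.

Lemma gibbs_density h : measurable_fun setT h -> (forall g, 0 <= h g)%R ->
  exists gam : probability G R, gibbs pi h = gam /\
    has_density pi gam (fun g => expR (- h g) / partition_fun pi (EFin \o h))%R.
Proof.
move=> mh h0; set W := partition_fun _ _.
have W_gt0 : (0 < W)%R by exact: partition_fun_gt0.
have [] := @density_probability _ _ _ pi (fun g => expR (- h g) / W)%R.
- apply: measurable_funM => //; apply: measurableT_comp => //.
  exact: measurableT_comp.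
- by move=> g; rewrite divr_ge0 ?expR_ge0// ltW.
- under eq_integral do rewrite EFinM.
  rewrite ge0_integralZr//.
  + rewrite -[X in X * _](@partition_funE _ _ _ pi (EFin \o h))//.
    * by rewrite -EFinM divff// gt_eqF.
    * exact/measurable_EFinP.
  + apply/measurable_EFinP; apply: measurableT_comp => //.
    exact: measurableT_comp.
  + by rewrite lee_fin invr_ge0 ltW.
move=> gam gamE; exists gam; split => [|A _]; last exact: gamE.
by apply/funext => A; rewrite gamE gibbs_ge0E.
Qed.

Lemma gibbs_probability h : measurable_fun setT h -> bounded_below h ->
  exists gam : probability G R, gibbs pi h = gam.
Proof.
move=> mh [c hc]; pose h' g := (h g - c)%R.
have mh' : measurable_fun setT h' by exact: measurable_funB.
have h'0 g : (0 <= h' g)%R by rewrite subr_ge0.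
have [gam [gamE _]] := gibbs_density mh' h'0.
exists gam; rewrite -gamE -(gibbs_shift c mh' h'0).
by congr gibbs; apply/funext => g; rewrite subrK.
Qed.

(** Measurability in the parameter comes from Tonelli: the normalizer and the mass of [A] are
    [pi]-integrals of jointly measurable functions. *)
Lemma gibbs_kernel d' (T : measurableType d') (s : T -> G -> R) :
    measurable_fun setT (fun tg : T * G => s tg.1 tg.2) ->
    (forall t, bounded_below (s t)) ->
  exists k : R.-pker T ~> G, forall t, gibbs pi (s t) = k t.
Proof.
move=> ms bs.
have mst t : measurable_fun setT (s t).
  exact: (measurableT_comp ms (measurable_pair1 t)).
have /choice[k kE] t := gibbs_probability (mst t) (bs t).
have mE : measurable_fun setT (fun tg : T * G => expR (- s tg.1 tg.2)).
  by apply: measurableT_comp => //; exact: measurableT_comp.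
pose W t : R := fine (\int[pi]_g (expR (- s t g))%:E).
have mW : measurable_fun setT W.
  apply: measurableT_comp => //.
  apply: (@measurable_fun_fubini_tonelli_F _ _ _ _ _ pi
    (fun tg => (expR (- s tg.1 tg.2))%:E)).
  - exact/measurable_EFinP.
  - by move=> tg; rewrite lee_fin expR_ge0.
have W0 t : (0 <= W t)%R.
  by apply: fine_ge0; apply: integral_ge0 => g _; rewrite lee_fin expR_ge0.
have mWV : measurable_fun setT (fun t => (W t)^-1)%R.
  rewrite (_ : (fun _ => _) = (fun t => powR (W t) (-1))); last first.
    by apply/funext => t; rewrite powR_inv1.
  exact: measurableT_comp (measurable_powR _) mW.
have mk A : measurable A -> measurable_fun setT (fun t => k t A).
  move=> mA; pose f (tg : T * G) :=
    (expR (- s tg.1 tg.2) / W tg.1 * \1_A tg.2)%:E.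
  rewrite (_ : (fun _ => _) = fun t => \int[pi]_g f (t, g)); last first.
    apply/funext => t; rewrite -kE /gibbs unlock integral_mkcond.
    apply: eq_integral => g _; rewrite /f /patch/= indicE.
    by case: ifPn => gA; rewrite ?(mulr1, mulr0).
  apply: measurable_fun_fubini_tonelli_F.
  - apply/measurable_EFinP; apply: measurable_funM.
      apply: measurable_funM => //.
      exact: measurableT_comp mWV measurable_fst.
    by apply: measurableT_comp measurable_snd; exact: measurable_indic.
  - by move=> tg; rewrite lee_fin mulr_ge0// divr_ge0// expR_ge0.
by exists (kernel_of mk) => t; rewrite kE.
Qed.

End gibbs_theory.
(** * The laws of the successive draws *)

Lemma measurable_fun_uncurry d d1 d2 d3 (T : measurableType d)
    (A : measurableType d1) (B : measurableType d2) (C : measurableType d3)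
    (F : A -> B -> C) (a : T -> A) (b : T -> B) :
    measurable_fun setT (fun ab : A * B => F ab.1 ab.2) ->
    measurable_fun setT a -> measurable_fun setT b ->
  measurable_fun setT (fun t => F (a t) (b t)).
Proof.
by move=> mF ma mb; exact: (measurableT_comp mF (measurable_fun_pair ma mb)).
Qed.

Section draws.
Context dZ dG (Z : measurableType dZ) (G : measurableType dG) (R : realType).
Variables (lam : R) (L : Z -> G -> R) (pi : probability G R).
Implicit Types S : G -> R.
Hypothesis lam_gt0 : (0 < lam)%R.
Hypothesis mL : measurable_fun setT (fun zg : Z * G => L zg.1 zg.2).

Let mLz z : measurable_fun setT (L z).
Proof. exact: (measurableT_comp mL (measurable_pair1 z)). Qed.

(** With [d = L z g' - L z g], completing the square gives [d + lam / 2 * d ^+ 2 >= - lam^-1 / 2],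
    so even an unbounded loss lowers the bound by a constant only. *)
Lemma bounded_below_next_score S z g :
  bounded_below S -> bounded_below (next_score lam L S z g).
Proof.
move=> [c Sc]; exists (c + L z g - lam^-1 / 2)%R => g'.
rewrite /next_score.
have -> : (S g' + L z g' + lam / 2 * (L z g' - L z g) ^+ 2 =
    S g' + L z g - lam^-1 / 2 +
    (1 + lam * (L z g' - L z g)) ^+ 2 / (2 * lam))%R.
  by field; rewrite gt_eqF.
have : (0 <= (1 + lam * (L z g' - L z g)) ^+ 2 / (2 * lam))%R.
  by rewrite divr_ge0 ?sqr_ge0// mulr_ge0// ltW.
by have := Sc g'; lra.
Qed.

Lemma bounded_belowM S :
  bounded_below S -> bounded_below (fun g => lam * S g)%R.
Proof. by move=> [c Sc]; exists (lam * c)%R => g; rewrite ler_pM2l. Qed.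

Lemma measurable_next_score d' (T : measurableType d') (s : T -> G -> R)
    (z : T -> Z) :
    measurable_fun setT (fun tg : T * G => s tg.1 tg.2) ->
    measurable_fun setT z ->
  measurable_fun setT (fun tg : T * G * G =>
    next_score lam L (s tg.1.1) (z tg.1.1) tg.1.2 tg.2).
Proof.
move=> ms mz; rewrite /next_score.
have mfst2 : measurable_fun setT (fun tg : T * G * G => tg.1.1).
  exact: measurableT_comp.
have mz2 : measurable_fun setT (fun tg : T * G * G => z tg.1.1).
  exact: measurableT_comp.
have mL1 : measurable_fun setT (fun tg : T * G * G => L (z tg.1.1) tg.2).
  exact: measurable_fun_uncurry.
have mL2 : measurable_fun setT (fun tg : T * G * G => L (z tg.1.1) tg.1.2).
  by apply: measurable_fun_uncurry => //; exact: measurableT_comp.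
apply: measurable_funD.
  by apply: measurable_funD => //; exact: measurable_fun_uncurry.
by apply: measurable_funM => //; apply: measurable_funX; exact: measurable_funB.
Qed.

Lemma measurable_next_score1 S z g : measurable_fun setT S ->
  measurable_fun setT (next_score lam L S z g).
Proof.
move=> mS; apply: measurable_funD; first exact: measurable_funD.
by apply: measurable_funM => //; apply: measurable_funX; exact: measurable_funB.
Qed.

Lemma gibbs_score_probability S : measurable_fun setT S -> bounded_below S ->
  exists gam : probability G R, gibbs pi (fun g => lam * S g)%R = gam.
Proof.
move=> mS bS; apply: gibbs_probability; last exact: bounded_belowM.
exact: measurable_funM.
Qed.

(** [draws_law] is a bare set function, and these two values suffice for the first marginal: once
    the first draw is fixed, the event that it lies in [A] is empty or full. *)
Lemma draws_law_set0_setT n S (z : n.-tuple Z) :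
    measurable_fun setT S -> bounded_below S ->
  draws_law lam L pi S z set0 = 0 /\ draws_law lam L pi S z setT = 1.
Proof.
elim: n S z => [|n IH] S z mS bS /=.
  have [gam ->] := gibbs_score_probability mS bS.
  by split; [exact: measure0|exact: probability_setT].
have [gam ->] := gibbs_score_probability mS bS.
have IH' g := IH (next_score lam L S (thead z) g) [tuple of behead z]
  (measurable_next_score1 _ _ mS) (bounded_below_next_score _ _ bS).
split.
- by rewrite integral0_eq// => g _; case: (IH' g).
- rewrite (eq_integral (cst 1)) ?integral_prob_cst// => g _.
  by case: (IH' g).
Qed.

(** The output law involves the joint law only through these marginals, so the joint law is never
    made a measure. *)
Definition draws_marginal n S (z : n.-tuple Z) (i : 'I_n.+1) (A : set G) :
  \bar R := draws_law lam L pi S z [set t | A (tnth t i)].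

Lemma draws_marginal0 n S (z : n.-tuple Z) A :
    measurable_fun setT S -> bounded_below S -> measurable A ->
  draws_marginal S z ord0 A = gibbs pi (fun g => lam * S g)%R A.
Proof.
case: n z => [|n] z mS bS mA; first by rewrite /draws_marginal/=.
rewrite /draws_marginal/=; have [gam ->] := gibbs_score_probability mS bS.
rewrite (eq_integral (EFin \o \1_A)) ?integral_indic ?setIT// => g _.
have [D0 DT] := draws_law_set0_setT [tuple of behead z]
  (measurable_next_score1 (thead z) g mS)
  (bounded_below_next_score (thead z) g bS).
rewrite /= indicE; have [/set_mem Ag|/negP nAg] := boolP (g \in A).
  rewrite -[RHS]DT; congr draws_law; apply/seteqP; split => // t _ /=.
rewrite -[RHS]D0; congr draws_law; apply/seteqP; split => // t /=.
rewrite (tnth_nth g)/= => Ag.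
by apply: nAg; rewrite inE.
Qed.

Lemma draws_marginalS n S (z : n.+1.-tuple Z) i A :
  draws_marginal S z (lift ord0 i) A =
  \int[gibbs pi (fun g => lam * S g)%R]_g
    draws_marginal (next_score lam L S (thead z) g) [tuple of behead z] i A.
Proof.
rewrite /draws_marginal/=; congr integral; apply/funext => g.
by congr draws_law; apply/seteqP; split => t /=; rewrite !(tnth_nth g).
Qed.

(** The parameter space varies in the induction: one round turns the first draw into a parameter, so
    [T] becomes [T * G]. *)
Lemma draws_marginal_kernel n d' (T : measurableType d') (s : T -> G -> R)
    (z : T -> n.-tuple Z) (i : 'I_n.+1) :
    measurable_fun setT (fun tg : T * G => s tg.1 tg.2) ->
    (forall t, bounded_below (s t)) -> measurable_fun setT z ->
  exists k : R.-pker T ~> G, forall t A, measurable A ->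
    k t A = draws_marginal (s t) (z t) i A.
Proof.
elim: n d' T s z i => [|n IH] d' T s z i ms bs mz.
all: have mst t : measurable_fun setT (s t)
  by exact: (measurableT_comp ms (measurable_pair1 t)).
all: have [k0 k0E] : exists k : R.-pker T ~> G,
    forall t, gibbs pi (fun g => lam * s t g)%R = k t
  by apply: gibbs_kernel => [|t];
    [exact: measurable_funM|exact: bounded_belowM].
all: case: (unliftP ord0 i) => [j ->|->].
- by case: j.
- by exists k0 => t A mA; rewrite draws_marginal0// k0E.
- pose s' (tg : T * G) := next_score lam L (s tg.1) (thead (z tg.1)) tg.2.
  pose z' (tg : T * G) : n.-tuple Z := [tuple of behead (z tg.1)].
  have mthead : measurable_fun setT (fun t => thead (z t)).
    exact: (measurableT_comp (measurable_tnth ord0) mz).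
  have mz' : measurable_fun setT z'.
    exact: (measurableT_comp (@measurable_behead _ Z n)
      (measurableT_comp mz measurable_fst)).
  have [k' k'E] := IH _ _ s' z' j (measurable_next_score ms mthead)
    (fun tg => bounded_below_next_score _ _ (bs tg.1)) mz'.
  (* Drawing first from [k0] and then from [k'] is a composition of kernels. *)
  pose k t : {measure set G -> \bar R} := (k0 \; k') t.
  have kT t : k t setT = 1.
    transitivity (\int[k0 t]_g k' (t, g) setT); first by [].
    rewrite (eq_integral (cst 1)) ?integral_cst ?mul1e//.
      exact: prob_kernel.
    by move=> g _; exact: prob_kernel.
  have /choice[kP kPE] t := measure_probability (kT t).
  have mk A : measurable A -> measurable_fun setT (fun t => kP t A).
    move=> mA; under eq_fun do rewrite kPE.
    exact: measurable_fun_mkcomp_sfinite.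
  exists (kernel_of mk) => t A mA.
  rewrite [LHS]kPE.
  rewrite draws_marginalS k0E /=.
  by apply: eq_integral => g _; rewrite k'E.
- by exists k0 => t A mA; rewrite draws_marginal0// k0E.
Qed.

End draws.
(** * Independent data *)

Section iid_law.
Context d (Z : measurableType d) (R : realType) (P : probability Z R).

Definition cons_pair n (zt : Z * n.-tuple Z) : n.+1.-tuple Z :=
  [tuple of zt.1 :: zt.2].

Let measurable_cons_pair n : measurable_fun setT (@cons_pair n).
Proof. exact: measurable_cons. Qed.

HB.instance Definition _ n :=
  isMeasurableFun.Build _ _ _ _ (@cons_pair n) (@measurable_cons_pair n).

(** The n-fold power of [P], built from the head so that its integral unfolds along the recursion of
    [draws_law]. *)
Fixpoint iid_law n : probability (n.-tuple Z) R :=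
  match n with
  | 0 => \d_([tuple] : 0.-tuple Z)
  | m.+1 => distribution (P \x iid_law m)%E (@cons_pair m)
  end.

Lemma ge0_integral_iid_lawS n (f : n.+1.-tuple Z -> \bar R) :
    measurable_fun setT f -> (forall z, 0 <= f z) ->
  \int[iid_law n.+1]_z f z =
  \int[P]_x \int[iid_law n]_t f [tuple of x :: t].
Proof.
move=> mf f0; rewrite /= ge0_integral_distribution//.
rewrite (@fubini_tonelli1 _ _ _ _ _ P (iid_law n))//.
  exact: measurableT_comp.
by move=> zt; exact: f0.
Qed.

Lemma measurable_rectangle n (A : 'I_n -> set Z) :
  (forall i, measurable (A i)) ->
  measurable [set t : n.-tuple Z | forall i, A i (tnth t i)].
Proof.
move=> mA.
rewrite (_ : [set _ | _] = \bigcap_(i in setT) ((fun t => tnth t i) @^-1` A i)).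
  apply: fin_bigcap_measurable => // i _.
  by rewrite -[X in measurable X]setTI; exact: measurable_tnth.
by apply/seteqP; split => [t At i _|t At i]; exact: At.
Qed.

Lemma iid_law_rectangle n (A : 'I_n -> set Z) : (forall i, measurable (A i)) ->
  iid_law n [set t | forall i, A i (tnth t i)] = \prod_(i < n) P (A i).
Proof.
elim: n A => [|n IH] A mA.
  rewrite big_ord0 /= diracE mem_set//=.
  by case.
rewrite big_ord_recl/= -(IH (fun i => A (lift ord0 i)))//.
have mI : measurable
    [set t : n.-tuple Z | forall i, A (lift ord0 i) (tnth t i)].
  exact: (@measurable_rectangle n (fun i => A (lift ord0 i)) (fun i => mA _)).
rewrite -product_measure1E//=.
congr (_ _); apply/seteqP; split => -[z t] /=.
- move=> At; split; first exact: (At ord0).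
  by move=> i; have := At (lift ord0 i); rewrite tnthS.
- move=> [Az At] i; have [j ->|->] := unliftP ord0 i; last exact: Az.
  by rewrite tnthS; exact: At.
Qed.

(** Rectangles form a generating class stable under intersection, and independence gives both laws
    the same value on them. *)
Lemma iid_distribution d' (Omega : measurableType d') (Pr : probability Omega R)
    n (X : 'I_n -> {RV Pr >-> Z}) (f : n.-tuple Z -> \bar R) :
    iid P X -> measurable_fun setT f -> (forall z, 0 <= f z) ->
  \int[Pr]_w f [tuple X i w | i < n] = \int[iid_law n]_z f z.
Proof.
move=> [XP Xindep] mf f0.
have mX : measurable_fun setT (fun w => [tuple X i w | i < n]).
  apply/measurable_fun_tnthP => i.
  rewrite (_ : _ \o _ = X i); first exact: measurable_funP.
  by apply/funext => w; rewrite /= tnth_mktuple.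
rewrite -[LHS](ge0_integral_distribution (mfun_Sub (mem_set mX)))//.
apply: eq_measure_integral => B mB _.
pose rect : set (set (n.-tuple Z)) := [set B | exists2 A : 'I_n -> set Z,
  (forall i, measurable (A i)) & B = [set t | forall i, A i (tnth t i)]].
apply: (@measure_unique _ R _ rect (fun=> setT)) => //.
- apply/seteqP; split.
    apply: smallest_sub; first exact: smallest_sigma_algebra.
    move=> A; rewrite -bigcup_seq => -[i _ [C mC <-]].
    apply: sub_sigma_algebra.
    (* A cylinder is the rectangle whose other sides are full. *)
    exists (fun j => if j == i then C else setT).
      by move=> j; case: ifP.
    apply/seteqP; split => t /=.
      by move=> [_ Ct] j; case: ifPn => // /eqP ->.
    by move=> /(_ i); rewrite eqxx.
  apply: smallest_sub; first exact: sigma_algebra_measurable.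
  by move=> _ [A mA ->]; exact: measurable_rectangle.
- move=> _ _ [A mA ->] [A' mA' ->]; exists (fun i => A i `&` A' i).
    by move=> i; exact: measurableI.
  apply/seteqP; split => t /=; first by move=> [At A't] i; split.
  by move=> AA't; split => i; have [] := AA't i.
- move=> _; exists (fun=> setT) => //.
  by apply/seteqP; split.
- by rewrite bigcup_const.
- move=> _ [A mA ->]; rewrite [RHS](iid_law_rectangle mA).
  transitivity (Pr (\bigcap_(i in [set` [set: 'I_n]%SET]) (X i @^-1` A i))).
    congr (Pr _); apply/seteqP; split => w /=.
      by move=> Aw i _; have := Aw i; rewrite tnth_mktuple.
    by move=> Aw i; rewrite tnth_mktuple; apply: Aw; rewrite /= inE.
  rewrite Xindep//; apply: eq_big => [i|i _]; first by rewrite inE.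
  by rewrite -(XP i).
- by move=> k; rewrite (le_lt_trans (probability_le1 _ _)) ?ltry.
Qed.

End iid_law.
(* [draws_law] and [seqrand_law] integrate against bare set functions, which
   [eq_measure_integral] does not cover. *)
Section eq_integral_set_fun.
Import HBNNSimple.

Lemma eq_integral_set_fun d (T : measurableType d) (R : realType)
    (m1 m2 : set T -> \bar R) (f : T -> \bar R) :
    (forall A, measurable A -> m1 A = m2 A) ->
  \int[m1]_x f x = \int[m2]_x f x.
Proof.
move=> m12; rewrite /integral.
have E (u : T -> \bar R) :
    [set sintegral m1 (h : {nnsfun T >-> R}) | h in
      [set h : {nnsfun T >-> R} | forall x, (h x)%:E <= u x]] =
    [set sintegral m2 (h : {nnsfun T >-> R}) | h in
      [set h : {nnsfun T >-> R} | forall x, (h x)%:E <= u x]].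
  have mh (h : {nnsfun T >-> R}) r : measurable (h @^-1` [set r]) by [].
  by apply/seteqP; split => _ [h hf <-]; exists h => //;
    apply: eq_fsbigr => r _; rewrite m12.
by congr (ereal_sup _ - ereal_sup _); exact: E.
Qed.

End eq_integral_set_fun.

(** * Marginals of the draws averaged over independent data *)

Section mean_marginal.
Context dZ dG (Z : measurableType dZ) (G : measurableType dG) (R : realType).
Variables (lam : R) (L : Z -> G -> R) (pi : probability G R)
  (P : probability Z R).
Implicit Types S : G -> R.
Hypothesis lam_gt0 : (0 < lam)%R.
Hypothesis mL : measurable_fun setT (fun zg : Z * G => L zg.1 zg.2).
Variable phi : G -> \bar R.
Hypothesis mphi : measurable_fun setT phi.
Hypothesis phi0 : forall g, 0 <= phi g.

Local Notation marg := (draws_marginal lam L pi).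
Local Notation next := (next_score lam L).

Lemma measurable_integral_marginal n d' (T : measurableType d')
    (s : T -> G -> R) (z : T -> n.-tuple Z) (i : 'I_n.+1) :
    measurable_fun setT (fun tg : T * G => s tg.1 tg.2) ->
    (forall t, bounded_below (s t)) -> measurable_fun setT z ->
  measurable_fun setT (fun t => \int[marg (s t) (z t) i]_g phi g).
Proof.
move=> ms bs mz.
have [k kE] := draws_marginal_kernel pi lam_gt0 mL i ms bs mz.
under eq_fun do rewrite -(eq_integral_set_fun _ (kE _)).
by apply: measurable_fun_integral_kernel => // A mA; exact: measurable_kernel.
Qed.

(** Positivity is not automatic for a bare set function; a kernel over the one-point space [unit]
    supplies a measure with the same values. *)
Lemma integral_marginal_ge0 n S (z : n.-tuple Z) (i : 'I_n.+1) :
    measurable_fun setT S -> bounded_below S ->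
  0 <= \int[marg S z i]_g phi g.
Proof.
move=> mS bS.
have [|k kE] := @draws_marginal_kernel _ _ _ _ _ _ _ pi lam_gt0 mL n _ unit
  (fun=> S) (fun=> z) i _ (fun=> bS) (measurable_cst _).
  exact: (measurableT_comp mS measurable_snd).
by rewrite -(eq_integral_set_fun _ (kE tt)); exact: integral_ge0.
Qed.

Definition mean_marginal n S (i : 'I_n.+1) : \bar R :=
  \int[iid_law P n]_z \int[marg S z i]_g phi g.

Lemma measurable_mean_marginal n d' (T : measurableType d')
    (s : T -> G -> R) (i : 'I_n.+1) :
    measurable_fun setT (fun tg : T * G => s tg.1 tg.2) ->
    (forall t, bounded_below (s t)) ->
  measurable_fun setT (fun t => mean_marginal (s t) i).
Proof.
move=> ms bs.
apply: (@measurable_fun_fubini_tonelli_F _ _ _ _ _ (iid_law P n)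
  (fun tz : T * n.-tuple Z => \int[marg (s tz.1) tz.2 i]_g phi g)).
  apply: (@measurable_integral_marginal _ _ _ (fun tz => s tz.1) snd) => //.
  apply: measurable_fun_uncurry => //.
  exact: measurableT_comp.
move=> tz; apply: integral_marginal_ge0 => //.
exact: (measurableT_comp ms (measurable_pair1 tz.1)).
Qed.

Lemma mean_marginal_ge0 n S (i : 'I_n.+1) :
  measurable_fun setT S -> bounded_below S -> 0 <= mean_marginal S i.
Proof.
move=> mS bS; apply: integral_ge0 => z _; exact: integral_marginal_ge0.
Qed.

Lemma mean_marginal0 n S : measurable_fun setT S -> bounded_below S ->
  @mean_marginal n S ord0 = \int[gibbs pi (fun g => lam * S g)%R]_g phi g.
Proof.
move=> mS bS; rewrite /mean_marginal.
under eq_integral => z _ do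
  rewrite (eq_integral_set_fun _ (fun A => @draws_marginal0 _ _ _ _ _ _ _
    pi lam_gt0 mL n S z A mS bS)).
exact: integral_prob_cst.
Qed.

(** The law of the first draw does not depend on the data, so Tonelli moves the integral over the
    remaining data inside the one over this draw. *)
Lemma mean_marginalS n S (i : 'I_n.+1) :
    measurable_fun setT S -> bounded_below S ->
  mean_marginal S (lift ord0 i) =
  \int[P]_z \int[gibbs pi (fun g => lam * S g)%R]_g
    mean_marginal (next S z g) i.
Proof.
move=> mS bS; rewrite /mean_marginal ge0_integral_iid_lawS; last 2 first.
- apply: (@measurable_integral_marginal _ _ _ (fun=> S) id) => //.
  exact: (measurableT_comp mS measurable_snd).
- by move=> z; exact: integral_marginal_ge0.
apply: eq_integral => z _.
have [gam gamE] := gibbs_score_probability pi lam_gt0 mS bS.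
rewrite gamE.
pose s (tg : n.-tuple Z * G) := next S z tg.2.
have ms : measurable_fun setT (fun tg : (n.-tuple Z * G) * G => s tg.1 tg.2).
  pose T := (n.-tuple Z)%type.
  exact: (@measurable_next_score _ _ _ _ _ _ L mL _ T (fun=> S) (fun=> z)
    (measurableT_comp mS measurable_snd) (measurable_cst _)).
have bs tg : bounded_below (s tg) by exact: bounded_below_next_score.
have [k kE] := draws_marginal_kernel pi lam_gt0 mL i ms bs measurable_fst.
have ml A : measurable A -> measurable_fun setT (fun _ : n.-tuple Z => gam A).
  by move=> _; exact: measurable_cst.
pose l := kernel_of ml.
transitivity
  (\int[iid_law P n]_t \int[gam]_g \int[marg (s (t, g)) t i]_g' phi g').
  apply: eq_integral => t _.
  rewrite (eq_integral_set_fun _ (m2 := kcomp l k t)); last first.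
    move=> A mA; rewrite draws_marginalS gamE /kcomp.
    apply: eq_integral => g _; rewrite kE// /s/= theadE.
    by congr draws_marginal; exact: val_inj.
  rewrite integral_kcomp//; apply: eq_integral => g _.
  exact: (eq_integral_set_fun _ (kE _)).
rewrite (@fubini_tonelli _ _ _ _ _ (iid_law P n) gam
  (fun tg => \int[marg (s tg) tg.1 i]_g' phi g'))//.
- exact: (@measurable_integral_marginal _ _ _ s fst).
- move=> tg; apply: integral_marginal_ge0 => //.
  exact: measurable_next_score1.
Qed.

End mean_marginal.
(** * The regret bound *)

Section curried_tonelli.
Context d1 d2 (A : measurableType d1) (B : measurableType d2) (R : realType).
Variables (P : probability A R) (Q : probability B R) (F : A -> B -> \bar R).
Hypothesis mF : measurable_fun setT (fun ab : A * B => F ab.1 ab.2).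
Hypothesis F0 : forall a b, 0 <= F a b.

Lemma measurable_integral_r : measurable_fun setT (fun a => \int[Q]_b F a b).
Proof.
by apply: (@measurable_fun_fubini_tonelli_F _ _ _ _ _ Q
  (fun ab => F ab.1 ab.2)).
Qed.

Lemma measurable_integral_l : measurable_fun setT (fun b => \int[P]_a F a b).
Proof.
by apply: (@measurable_fun_fubini_tonelli_G _ _ _ _ _ P
  (fun ab => F ab.1 ab.2)).
Qed.

Lemma integral_swap :
  \int[P]_a \int[Q]_b F a b = \int[Q]_b \int[P]_a F a b.
Proof.
by apply: (@fubini_tonelli _ _ _ _ _ P Q (fun ab => F ab.1 ab.2)).
Qed.

End curried_tonelli.

Lemma integral_prob_affine d (T : measurableType d) (R : realType)
    (P : probability T R) (f : T -> \bar R) (a b : \bar R) :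
    measurable_fun setT f -> (forall x, 0 <= f x) -> 0 <= a -> 0 <= b ->
  \int[P]_x (a + f x + b) = a + \int[P]_x f x + b.
Proof.
move=> mf f0 a0 b0; rewrite ge0_integralD//.
- by rewrite ge0_integralD// !integral_prob_cst.
- by move=> x _; rewrite adde_ge0.
- exact: emeasurable_funD.
Qed.

Section regret.
Context dZ dG (Z : measurableType dZ) (G : measurableType dG) (R : realType).
Variables (lam : R) (L : Z -> G -> R) (pi rho : probability G R)
  (P : probability Z R).
Implicit Types (S h : G -> R) (z : Z) (g : G).
Hypothesis lam_gt0 : (0 < lam)%R.
Hypothesis mL : measurable_fun setT (fun zg : Z * G => L zg.1 zg.2).

Local Notation next := (next_score lam L).

Let mLz z : measurable_fun setT (L z).
Proof. exact: (measurableT_comp mL (measurable_pair1 z)). Qed.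

Definition loss_deviation z g g' : R := deviation (lam * L z g) (lam * L z g').

Local Notation D := loss_deviation.

Lemma loss_deviation_ge0 z g g' : (0 <= D z g g')%R.
Proof. exact: deviation_ge0. Qed.

Lemma loss_deviationE z g g' : D z g g' =
  (1 / 2 + lam * (L z g - L z g') + lam ^+ 2 / 2 * (L z g - L z g') ^+ 2)%R.
Proof. by rewrite /D /deviation; field. Qed.

Lemma measurable_loss_deviation d (T : measurableType d)
    (z : T -> Z) (a b : T -> G) :
    measurable_fun setT z -> measurable_fun setT a -> measurable_fun setT b ->
  measurable_fun setT (fun t => D (z t) (a t) (b t)).
Proof.
move=> mz ma mb; apply: measurable_funM => //; apply: measurable_funX.
apply: measurable_funD => //.
by apply: measurable_funB; apply: measurable_funM => //;
  exact: measurable_fun_uncurry.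
Qed.

(* Completing the square: [lam * next S z g'] is [lam * S] plus the nonnegative
   deviation, up to a constant that [gibbs] ignores. *)
Lemma scale_next_score S h c z g' : (forall g, lam * S g = h g + c)%R ->
  forall g, (lam * next S z g' g =
    (h g + D z g g') + (c + lam * L z g' - 1 / 2))%R.
Proof.
move=> Sh g; by rewrite /next_score /D /deviation !mulrDr Sh; field.
Qed.

Definition mean_deviation g' : \bar R := \int[P]_z \int[rho]_g (D z g g')%:E.

Let q z g' : \bar R := \int[rho]_g (D z g g')%:E.

Let q0 z g' : 0 <= q z g'.
Proof. by apply: integral_ge0 => g _; rewrite lee_fin loss_deviation_ge0. Qed.

Let mq : measurable_fun setT (fun zg : Z * G => q zg.1 zg.2).
Proof.
apply: (@measurable_integral_r _ _ _ _ _ rho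
  (fun (zg : Z * G) g => (D zg.1 g zg.2)%:E)).
- apply/measurable_EFinP; apply: measurable_loss_deviation => //;
    exact: measurableT_comp.
- by move=> zg g; rewrite lee_fin loss_deviation_ge0.
Qed.

Lemma mean_deviation_ge0 g' : 0 <= mean_deviation g'.
Proof. by apply: integral_ge0 => z _; exact: q0. Qed.

Lemma measurable_mean_deviation : measurable_fun setT mean_deviation.
Proof. exact: (measurable_integral_l P mq q0). Qed.

Let free_energy_add h z g' := free_energy pi (fun g => h g + D z g g')%R.

(** One round in the abstract: in [H], the remaining rounds gain [r] at cost [E]. Averaging [H] over
    the draw adds the gain 1/2 of [variance_step] and the cost [mean_deviation]. *)
Lemma regret_step h (gam : probability G R) (E : Z -> G -> \bar R) (r : R) :
    measurable_fun setT h -> (forall g, 0 <= h g)%R ->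
    has_density pi gam
      (fun a => expR (- h a) / partition_fun pi (EFin \o h))%R ->
    measurable_fun setT (fun zg : Z * G => E zg.1 zg.2) ->
    (forall z g, 0 <= E z g) -> (0 <= r)%R ->
    (forall z g', (free_energy_add h z g' + r)%:E <=
      \int[rho]_g (h g + D z g g')%:E + E z g' + KL rho pi) ->
  (free_energy pi h + (r + 1 / 2))%:E <=
  \int[rho]_g (h g)%:E +
    (\int[gam]_g mean_deviation g + \int[P]_z \int[gam]_g E z g) +
    KL rho pi.
Proof.
move=> mh h0 gamE mE E0 r0 H.
have mqz z : measurable_fun setT (q z).
  exact: (measurableT_comp mq (measurable_pair1 z)).
have mEz z : measurable_fun setT (E z).
  exact: (measurableT_comp mE (measurable_pair1 z)).
have mq' := measurable_integral_r gam mq q0.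
have mE' := measurable_integral_r gam mE E0.
have inth0 : 0 <= \int[rho]_g (h g)%:E.
  by apply: integral_ge0 => g _; rewrite lee_fin.
have KL0 := KL_ge0 pi rho.
have q'0 z : 0 <= \int[gam]_g q z g by exact: integral_ge0.
have E'0 z : 0 <= \int[gam]_g E z g by exact: integral_ge0.
(* The example stays fixed here, so that [variance_step] applies to [lam * L z]; the average over
   [P] comes afterwards. *)
have Hz z : (free_energy pi h + (r + 1 / 2))%:E <=
    \int[rho]_g (h g)%:E + (\int[gam]_g q z g + \int[gam]_g E z g) +
    KL rho pi.
  have mx : measurable_fun setT (fun g => lam * L z g)%R.
    exact: measurable_funM.
  have mF : measurable_fun setT (free_energy_add h z).
    exact: measurable_free_energy_deviation.
  have F0 g : (0 <= free_energy_add h z g)%R.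
    apply: free_energy_ge0.
      by apply: measurable_funD => //; exact: measurable_deviationl.
    by move=> a; rewrite addr_ge0// deviation_ge0.
  have := variance_step mx mh h0 gamE; rewrite -(@leeD2rE _ r%:E)// -EFinD.
  rewrite -addrA [(1 / 2 + r)%R]addrC => /le_trans; apply.
  rewrite -ge0_integralD//.
  rewrite -[leRHS](@integral_prob_affine _ _ _ gam (fun g => q z g + E z g))//.
  2: exact: emeasurable_funD.
  2: by move=> g; rewrite adde_ge0.
  rewrite -[leLHS]add0e [leLHS]addeA.
  rewrite -[leLHS](@integral_prob_affine _ _ _ gam
    (fun g => (free_energy_add h z g)%:E))//; last exact/measurable_EFinP.
  apply: ge0_le_integral => //.
  - by move=> g _; rewrite add0e adde_ge0 ?lee_fin//; exact: F0.
  - do 2 apply: emeasurable_funD => //; exact/measurable_EFinP.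
  - by do 2 apply: emeasurable_funD => //; exact: emeasurable_funD.
  move=> g' _; rewrite add0e (le_trans (H z g'))// addeA leeD2r// leeD2r//.
  under eq_integral do rewrite EFinD.
  rewrite ge0_integralD//.
  - by move=> g _; rewrite lee_fin.
  - exact/measurable_EFinP.
  - by move=> g _; rewrite lee_fin loss_deviation_ge0.
  - by apply/measurable_EFinP; exact: measurable_loss_deviation.
rewrite /mean_deviation -(integral_swap P gam mq q0).
rewrite -ge0_integralD// -integral_prob_affine//; last 2 first.
- exact: emeasurable_funD.
- by move=> z; rewrite adde_ge0.
rewrite -[leLHS](integral_prob_cst P).
apply: ge0_le_integral => //.
- by move=> z _; rewrite lee_fin !addr_ge0// free_energy_ge0.
- by do 2 apply: emeasurable_funD => //; exact: emeasurable_funD.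
Qed.

(** [h], [S] and [c] vary in the induction because the next round starts from [next S z g']: its [h]
    has gained a deviation and its [c] depends on [z] and [g']. *)
Lemma regret_bound n h S c :
    measurable_fun setT h -> (forall g, 0 <= h g)%R ->
    (forall g, lam * S g = h g + c)%R ->
  (free_energy pi h + n.+1%:R / 2)%:E <=
  \int[rho]_g (h g)%:E +
    \sum_(i < n.+1) mean_marginal lam L pi P mean_deviation S i + KL rho pi.
Proof.
have mmd := measurable_mean_deviation; have md0 := mean_deviation_ge0.
elim: n h S c => [|n IH] h S c mh h0 Sh.
all: have [gam [gamE gamd]] := gibbs_density pi mh h0.
all: have SfE : S = (fun g => lam^-1 * (h g + c))%R
  by apply/funext => g; rewrite -Sh mulKf// gt_eqF.
all: have mS : measurable_fun setT S
  by rewrite SfE; apply: measurable_funM => //; exact: measurable_funD.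
all: have bS : bounded_below S
  by exists (lam^-1 * c)%R => g; rewrite SfE ler_pM2l ?invr_gt0// lerDr.
all: have SE : gibbs pi (fun g => lam * S g)%R = gam
  by rewrite -gamE -(gibbs_shift pi c mh h0); congr gibbs; apply/funext.
all: have mhD z g' : measurable_fun setT (fun g => h g + D z g g')%R
  by apply: measurable_funD => //; exact: measurable_loss_deviation.
all: have hD0 z g' g : (0 <= h g + D z g g')%R
  by rewrite addr_ge0// loss_deviation_ge0.
(* No data are left, yet the last draw still gains 1/2 on a fresh example; the hypothesis of
   [regret_step] is then Donsker-Varadhan itself. *)
- have := @regret_step h gam (fun _ _ => 0) 0%R mh h0 gamd (measurable_cst _)
    (fun _ _ => lexx _) (lexx _).
  rewrite big_ord_recl big_ord0 mean_marginal0// SE.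
  rewrite (_ : \int[P]_z \int[gam]_g 0 = 0); last by rewrite !integral_prob_cst.
  rewrite add0r; apply => z g'; rewrite addr0 adde0.
  apply: (donsker_varadhan rho (h := fun g => (h g + D z g g')%:E)).
  + exact/measurable_EFinP.
  + by move=> g; rewrite lee_fin.
  + exact: partition_fun_gt0.
pose E z g : \bar R := \sum_(i < n.+1)
  mean_marginal lam L pi P mean_deviation (next S z g) i.
have mnext z g : measurable_fun setT (next S z g).
  exact: measurable_next_score1.
have bnext z g : bounded_below (next S z g).
  exact: bounded_below_next_score.
have mmm (i : 'I_n.+1) : measurable_fun setT (fun zg : Z * G =>
    mean_marginal lam L pi P mean_deviation (next S zg.1 zg.2) i).
  apply: measurable_mean_marginal => //.
  exact: (@measurable_next_score _ _ _ _ _ _ L mL _ Z (fun=> S) id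
    (measurableT_comp mS measurable_snd) (@measurable_id _ _ _)).
have mm0 z g (i : 'I_n.+1) :
    0 <= mean_marginal lam L pi P mean_deviation (next S z g) i.
  exact: mean_marginal_ge0.
have := @regret_step h gam E (n.+1%:R / 2)%R mh h0 gamd _ _ _ _.
rewrite big_ord_recl mean_marginal0// SE.
have -> : \int[P]_z \int[gam]_g E z g = \sum_(i < n.+1)
    mean_marginal lam L pi P mean_deviation S (lift ord0 i).
  under [RHS]eq_bigr do rewrite mean_marginalS// SE.
  rewrite -ge0_integral_sum//; last 2 first.
  - by move=> i; exact: (measurable_integral_r gam (mmm i)).
  - by move=> i z _; exact: integral_ge0.
  apply: eq_integral => z _; rewrite -ge0_integral_sum// => i.
  exact: (measurableT_comp (mmm i) (measurable_pair1 z)).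
rewrite (_ : n.+2%:R / 2 = n.+1%:R / 2 + 1 / 2)%R; last first.
  by rewrite -mulrDl natr1.
apply => //.
- exact: emeasurable_sum.
- by move=> z g; exact: sume_ge0.
- by move=> z g'; apply: IH => //; exact: scale_next_score.
Qed.

End regret.
(** * The averaged randomizing distribution *)

Section mixture.
Context dO dG (Omega : measurableType dO) (G : measurableType dG)
  (R : realType).
Variables (Pr : probability Omega R) (k : R.-pker Omega ~> G).

(** [Pr] is seen as a kernel from the one-point space, so that the mixture is a composition of
    kernels. *)
Lemma mixture_probability : exists mub : probability G R,
  forall f, measurable_fun setT f -> (forall g, 0 <= f g) ->
  \int[Pr]_w \int[k w]_g f g = \int[mub]_g f g.
Proof.
have ml A : measurable A -> measurable_fun setT (fun _ : unit => Pr A).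
  by move=> _; exact: measurable_cst.
have [kP kPE] : exists kP : Omega -> probability G R,
    forall w A, kP w A = k w A.
  have /choice[kP kPE] w := measure_probability (@prob_kernel _ _ _ _ _ k w).
  by exists kP.
have mk A : measurable A ->
    measurable_fun setT (fun tw : unit * Omega => kP tw.2 A).
  move=> mA; under eq_fun do rewrite kPE.
  exact: measurableT_comp (measurable_kernel k _ mA) measurable_snd.
pose m : {measure set G -> \bar R} := mkcomp (kernel_of ml) (kernel_of mk) tt.
have mT : m setT = 1.
  transitivity (\int[Pr]_w kP w setT); first by [].
  rewrite (eq_integral (cst 1)) ?integral_prob_cst// => w _.
  exact: probability_setT.
have [mub mubE] := measure_probability mT.
exists mub => f mf f0.
rewrite [RHS](eq_integral_set_fun _ (m2 := m))//.
rewrite [RHS](integral_kcomp (kernel_of ml) (kernel_of mk))//.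
apply: eq_integral => w _; apply: eq_integral_set_fun => A _.
by rewrite -kPE.
Qed.

Variable mub : probability G R.
Hypothesis mubE : forall f, measurable_fun setT f -> (forall g, 0 <= f g) ->
  \int[Pr]_w \int[k w]_g f g = \int[mub]_g f g.

Let mkf (f : G -> \bar R) : measurable_fun setT f -> (forall g, 0 <= f g) ->
  measurable_fun setT (fun w => \int[k w]_g f g).
Proof.
move=> mf f0; apply: measurable_fun_integral_kernel => // A mA.
exact: measurable_kernel.
Qed.

Lemma integral_mixture f : mub.-integrable setT f ->
  \int[Pr]_w \int[k w]_g f g = \int[mub]_g f g.
Proof.
move=> intf; have mf := measurable_int _ intf.
have mfp := measurable_funepos mf; have mfn := measurable_funeneg mf.
under eq_integral do rewrite integralE.
rewrite integralB//.
- by rewrite !mubE// -integralE.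
- apply/integrableP; split; first exact: mkf.
  under eq_integral do rewrite gee0_abs ?integral_ge0//.
  by rewrite mubE//; exact: integral_funepos_lt_pinfty.
- apply/integrableP; split; first exact: mkf.
  under eq_integral do rewrite gee0_abs ?integral_ge0//.
  by rewrite mubE//; exact: integral_funeneg_lt_pinfty.
Qed.

(** The [mub]-mass of the exceptional set is the mean of its masses under [k w], so it is null for
    almost every [w]. *)
Lemma integral_mixtureNy f : measurable_fun setT f ->
    {ae mub, forall g, f g = -oo} ->
  \int[Pr]_w \int[k w]_g f g = -oo.
Proof.
move=> mf [N [mN N0 sub]].
have mfp := measurable_funepos mf; have mfn := measurable_funeneg mf.
have : \int[Pr]_w `|k w N| = 0.
  under eq_integral do rewrite gee0_abs//.
  transitivity (\int[mub]_g (\1_N g)%:E); last first.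
    by rewrite integral_indic// setIT.
  rewrite -mubE.
  - by apply: eq_integral => w _; rewrite integral_indic// setIT.
  - exact/measurable_EFinP.
  - by move=> g; rewrite lee_fin.
move/(ae_eq_integral_abs Pr measurableT (measurable_kernel k _ mN)) => kN0.
rewrite -[RHS](integral_prob_cst Pr); apply: ae_eq_integral => //.
  under eq_fun do rewrite integralE.
  by apply: emeasurable_funB; exact: mkf.
apply: filterS kN0 => w /= /(_ Logic.I) kwN _.
transitivity (\int[k w]_g (cst -oo g)).
  apply: ae_eq_integral => //.
  exists N; split => //; apply: subset_trans sub => g /= H Hg.
  by apply: H => _.
rewrite integral_cst// [X in _ * X](_ : _ = 1) ?mule1//.
exact: prob_kernel.
Qed.

End mixture.

(** * The randomizing distribution as a kernel, and its regret *)

Section seqrand_kernel.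
Context dZ dG dO (Z : measurableType dZ) (G : measurableType dG)
  (Omega : measurableType dO) (R : realType).
Variables (lam : R) (L : Z -> G -> R) (pi : probability G R)
  (P : probability Z R) (Pr : probability Omega R)
  (n : nat) (X : 'I_n -> {RV Pr >-> Z}).
Hypothesis lam_gt0 : (0 < lam)%R.
Hypothesis mL : measurable_fun setT (fun zg : Z * G => L zg.1 zg.2).

Let data w := [tuple X i w | i < n].

Let mdata : measurable_fun setT data.
Proof.
apply/measurable_fun_tnthP => i.
rewrite (_ : _ \o _ = X i); first exact: measurable_funP.
by apply/funext => w; rewrite /= tnth_mktuple.
Qed.

Let S0 : G -> R := cst 0%R.

Let bS0 : bounded_below S0.
Proof. by exists 0%R. Qed.

Lemma seqrand_kernel : exists k : R.-pker Omega ~> G,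
  (forall w A, measurable A -> k w A = seqrand_law lam L pi (data w) A) /\
  (forall w f, measurable_fun setT f -> (forall g, 0 <= f g) ->
    \int[k w]_g f g = (n.+1%:R^-1)%:E *
      \sum_(i < n.+1) \int[draws_marginal lam L pi S0 (data w) i]_g f g).
Proof.
have /choice[kap kapE] (i : 'I_n.+1) : exists k : R.-pker Omega ~> G,
    forall w A, measurable A ->
    k w A = draws_marginal lam L pi S0 (data w) i A.
  apply: (draws_marginal_kernel pi lam_gt0 mL i (s := fun=> S0)) => //.
have n0 : (0 <= n.+1%:R^-1 :> R)%R by rewrite invr_ge0.
(* [msum] is indexed by natural numbers, whence [inord]. *)
pose m w : {measure set G -> \bar R} :=
  mscale (NngNum n0) (msum (fun i => kap (inord i) w) n.+1).
have mE w A : m w A = (n.+1%:R^-1)%:E * \sum_(i < n.+1) kap i w A.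
  rewrite /m /mscale/= /msum; congr (_ * _).
  by apply: eq_bigr => i _; rewrite inord_val.
have mT w : m w setT = 1.
  rewrite mE (eq_bigr (fun=> 1%R%:E)); last by move=> i _; exact: prob_kernel.
  by rewrite sumEFin sumr_const card_ord -EFinM mulVf.
have /choice[kP kPE] w := measure_probability (mT w).
have mk A : measurable A -> measurable_fun setT (fun w => kP w A).
  move=> mA; under eq_fun do rewrite kPE mE.
  apply: emeasurable_funM => //; apply: emeasurable_sum => i.
  exact: measurable_kernel.
exists (kernel_of mk); split => [w A mA|w f mf f0].
  rewrite [LHS]kPE mE /seqrand_law; congr (_ * _).
  by apply: eq_bigr => i _; rewrite kapE.
rewrite (eq_integral_set_fun _ (m2 := m w)); last by move=> A mA; exact: kPE.
rewrite ge0_integral_mscale//= ge0_integral_measure_sum//.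
congr (_ * _); apply: eq_bigr => i _; rewrite inord_val.
exact: (eq_integral_set_fun _ (kapE i w)).
Qed.

Hypothesis iidX : iid P X.

Lemma integral_marginal_data f (i : 'I_n.+1) :
    measurable_fun setT f -> (forall g, 0 <= f g) ->
  \int[Pr]_w \int[draws_marginal lam L pi S0 (data w) i]_g f g =
  mean_marginal lam L pi P f S0 i.
Proof.
move=> mf f0; apply: (iid_distribution iidX
  (f := fun z => \int[draws_marginal lam L pi S0 z i]_g f g)).
- by apply: (measurable_integral_marginal pi lam_gt0 mL mf f0 (s := fun=> S0)).
- by move=> z; apply: integral_marginal_ge0.
Qed.

(** From the zero score the initial free energy is 0, and the sum over the draws is [n.+1] times the
    mean under the uniformly chosen output. *)
Lemma seqrand_mixture : exists (k : R.-pker Omega ~> G) (mub : probability G R),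
  [/\ forall w A, measurable A -> k w A = seqrand_law lam L pi (data w) A,
      forall f, measurable_fun setT f -> (forall g, 0 <= f g) ->
        \int[Pr]_w \int[k w]_g f g = \int[mub]_g f g &
      forall rho : probability G R, (n.+1%:R / 2)%:E <=
        n.+1%:R%:E * \int[mub]_g mean_deviation lam L rho P g + KL rho pi].
Proof.
have [k [kE kint]] := seqrand_kernel.
have [mub mubE] := mixture_probability Pr k.
exists k, mub; split => // rho.
have mmd := @measurable_mean_deviation _ _ _ _ _ lam L rho P mL.
have md0 := @mean_deviation_ge0 _ _ _ _ _ lam L rho P.
have S00 g : (lam * S0 g = cst 0 g + 0)%R by rewrite mulr0 addr0.
have := @regret_bound _ _ _ _ _ lam L pi rho P lam_gt0 mL n (cst 0%R) S0 0%R
  (measurable_cst _) (fun=> lexx _) S00.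
rewrite integral0 add0e /free_energy.
have -> : partition_fun pi (EFin \o cst 0%R) = 1%R.
  by rewrite /partition_fun /boltzmann/= oppr0 expR0 integral_prob_cst.
rewrite ln1 oppr0 add0r => H.
apply: (le_trans H).
rewrite leeD2r// -mubE//.
under [in leRHS]eq_integral do rewrite kint//.
rewrite ge0_integralZl//.
- rewrite muleA -EFinM divff// mul1e ge0_integral_sum//.
  + by apply: lee_sum => i _; rewrite integral_marginal_data.
  + move=> i; apply: (measurable_integral_marginal pi lam_gt0 mL mmd md0
      (s := fun=> S0)) => //.
  + by move=> i w _; exact: integral_marginal_ge0.
- apply: emeasurable_sum => i.
  apply: (measurable_integral_marginal pi lam_gt0 mL mmd md0
      (s := fun=> S0)) => //.
- by move=> w _; apply: sume_ge0 => i _; exact: integral_marginal_ge0.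
Qed.

End seqrand_kernel.
(** * Risks and pairwise second moments *)

Lemma norm_le1Dsqr (R : realDomainType) (x : R) : (`|x| <= 1 + x ^+ 2)%R.
Proof.
rewrite -real_normK ?num_real//; have := sqr_ge0 (`|x| - 1)%R.
by have := normr_ge0 x; move: `|x|%R => y; nra.
Qed.

Lemma integral_affine2 d (T : measurableType d) (R : realType)
    (Q : probability T R) (f v : T -> \bar R) (a b c : R) :
    Q.-integrable setT f -> Q.-integrable setT v ->
  \int[Q]_x (a%:E + b%:E * f x + c%:E * v x) =
  a%:E + b%:E * \int[Q]_x f x + c%:E * \int[Q]_x v x.
Proof.
move=> fi vi; have ai := finite_measure_integrable_cst Q a measurableT.
have bf := integrableZl measurableT b fi.
have cv := integrableZl measurableT c vi.
rewrite integralD//; last exact: integrableD.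
by rewrite integralD// !integralZl// integral_prob_cst.
Qed.

(** Here [a, b], then [c, f], then [p, q] stand for the integrals of the positive and negative parts
    of a sum and of its two terms. The bounds carry the finiteness of [c] or [f] over to [a] or
    [b]. *)
Lemma sube_eq_quasi (R : realDomainType) (a b c f : \bar R) (p q : R) :
    0 <= a -> 0 <= b -> 0 <= c -> 0 <= f -> c < +oo \/ f < +oo ->
    a <= c + p%:E -> b <= f + q%:E -> a + f + q%:E = b + c + p%:E ->
  a - b = c - f + (p%:E - q%:E).
Proof.
case: a => [a||] // _; case: b => [b||] // _; case: c => [c||] // _;
  case: f => [f||] // _ => -[] // _ _ _ //.
all: by rewrite -!EFinD -?EFinB => -[] H; congr EFin; lra.
Qed.

(** Allows an integrable change of loss even where the risk is infinite. It rests on the identity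
    u^+ + v^- + e^- = u^- + v^+ + e^+ for u = v + e. *)
Lemma integralD_quasi d (T : measurableType d) (R : realType)
    (P : probability T R) (v e : T -> R) :
    measurable_fun setT v -> P.-integrable setT (EFin \o e) ->
    quasi_integrable P (EFin \o v) ->
  \int[P]_x (v x + e x)%:E = \int[P]_x (v x)%:E + \int[P]_x (e x)%:E.
Proof.
move=> mv ie qv; have me := measurable_int _ ie.
pose u x := (v x + e x)%R.
have mu : measurable_fun setT u.
  by apply: measurable_funD => //; exact/measurable_EFinP.
pose U := EFin \o u; pose V := EFin \o v; pose E := EFin \o e.
have mU : measurable_fun setT U by exact/measurable_EFinP.
have mV : measurable_fun setT V by exact/measurable_EFinP.
have [mUp mUn] := (measurable_funepos mU, measurable_funeneg mU).
have [mVp mVn] := (measurable_funepos mV, measurable_funeneg mV).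
have [mEp mEn] := (measurable_funepos me, measurable_funeneg me).
have maxN (y : R) : (Num.max (- y) 0 = Num.max y 0 - y)%R.
  by case: (leP y 0%R); case: (leP (- y)%R 0%R); lra.
have ptw x : [/\ U^\+ x <= V^\+ x + E^\+ x, U^\- x <= V^\- x + E^\- x &
    U^\+ x + V^\- x + E^\- x = U^\- x + V^\+ x + E^\+ x].
  rewrite !funeposE !funenegE /U /V /E /u/= -?EFinN -!EFin_max -!EFinD !lee_fin.
  rewrite !maxN; split; [| |congr EFin];
    case: (leP (v x + e x)%R 0%R); case: (leP (v x) 0%R);
    case: (leP (e x) 0%R); lra.
have I1 : \int[P]_x U^\+ x <= \int[P]_x V^\+ x + \int[P]_x E^\+ x.
  rewrite -ge0_integralD//; apply: ge0_le_integral => //.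
  - exact: emeasurable_funD.
  - by move=> x _; have [] := ptw x.
have I2 : \int[P]_x U^\- x <= \int[P]_x V^\- x + \int[P]_x E^\- x.
  rewrite -ge0_integralD//; apply: ge0_le_integral => //.
  - exact: emeasurable_funD.
  - by move=> x _; have [] := ptw x.
have I3 : \int[P]_x U^\+ x + \int[P]_x V^\- x + \int[P]_x E^\- x =
    \int[P]_x U^\- x + \int[P]_x V^\+ x + \int[P]_x E^\+ x.
  rewrite -!ge0_integralD//; try exact: emeasurable_funD;
    try by move=> x _; rewrite adde_ge0.
  by apply: eq_integral => x _; have [] := ptw x.
have Ep := integral_funepos_lt_pinfty measurableT ie.
have En := integral_funeneg_lt_pinfty measurableT ie.
have Ep0 : 0 <= \int[P]_x E^\+ x by exact: integral_ge0.
have En0 : 0 <= \int[P]_x E^\- x by exact: integral_ge0.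
have Up0 : 0 <= \int[P]_x U^\+ x by exact: integral_ge0.
have Un0 : 0 <= \int[P]_x U^\- x by exact: integral_ge0.
have Vp0 : 0 <= \int[P]_x V^\+ x by exact: integral_ge0.
have Vn0 : 0 <= \int[P]_x V^\- x by exact: integral_ge0.
rewrite [LHS](integralE _ _ U) [X in _ = X + _](integralE _ _ V).
rewrite [X in _ = _ + X](integralE _ _ E).
have Epf : \int[P]_x E^\+ x \is a fin_num by rewrite ge0_fin_numE.
have Enf : \int[P]_x E^\- x \is a fin_num by rewrite ge0_fin_numE.
rewrite -(fineK Epf) -(fineK Enf) in I1 I2 I3 *.
exact: sube_eq_quasi.
Qed.

Section risk_theory.
Context dZ dG (Z : measurableType dZ) (G : measurableType dG) (R : realType).
Variables (lam : R) (L : Z -> G -> R) (P : probability Z R).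
Hypothesis lam_gt0 : (0 < lam)%R.
Hypothesis mL : measurable_fun setT (fun zg : Z * G => L zg.1 zg.2).

Let mLg g : measurable_fun setT (fun z => L z g).
Proof. exact: (measurableT_comp mL (measurable_pair2 g)). Qed.

Lemma riskE g : risk P L g = \int[P]_z (L z g)%:E.
Proof. by rewrite /risk unlock. Qed.

Lemma VE g g' : V P L g g' = \int[P]_z ((L z g - L z g') ^+ 2)%:E.
Proof. by rewrite /V unlock. Qed.

Lemma V_ge0 g g' : 0 <= V P L g g'.
Proof. by rewrite VE; apply: integral_ge0 => z _; rewrite lee_fin sqr_ge0. Qed.

Lemma measurable_risk : measurable_fun setT (risk P L).
Proof.
rewrite (_ : risk P L = fun g => \int[P]_z (fun zg : Z * G =>
    (L zg.1 zg.2)%:E)^\+ (z, g) - \int[P]_z (fun zg : Z * G =>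
    (L zg.1 zg.2)%:E)^\- (z, g)); last first.
  apply/funext => g; rewrite riskE integralE; congr (_ - _);
    by apply: eq_integral => z _; rewrite ?funeposE ?funenegE.
have mE : measurable_fun setT (fun zg : Z * G => (L zg.1 zg.2)%:E).
  exact/measurable_EFinP.
apply: emeasurable_funB.
- apply: (@measurable_fun_fubini_tonelli_G _ _ _ _ _ P) => //.
  exact: measurable_funepos.
- apply: (@measurable_fun_fubini_tonelli_G _ _ _ _ _ P) => //.
  exact: measurable_funeneg.
Qed.

Let mdiff d (T : measurableType d) (z : T -> Z) (a b : T -> G) :
    measurable_fun setT z -> measurable_fun setT a -> measurable_fun setT b ->
  measurable_fun setT (fun t => (L (z t) (a t) - L (z t) (b t)))%R.
Proof.
by move=> mz ma mb; apply: measurable_funB; exact: measurable_fun_uncurry.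
Qed.

Lemma measurable_V : measurable_fun setT (fun gg : G * G => V P L gg.1 gg.2).
Proof.
under eq_fun do rewrite VE.
apply: (@measurable_integral_r _ _ _ _ _ P
  (fun (gg : G * G) z => ((L z gg.1 - L z gg.2) ^+ 2)%:E)).
- apply/measurable_EFinP; apply: measurable_funX; apply: mdiff => //;
    exact: measurableT_comp.
- by move=> gg z; rewrite lee_fin sqr_ge0.
Qed.

Definition pair_deviation g g' : \bar R :=
  \int[P]_z (loss_deviation lam L z g g')%:E.

Lemma pair_deviation_ge0 g g' : 0 <= pair_deviation g g'.
Proof. by apply: integral_ge0 => z _; rewrite lee_fin loss_deviation_ge0. Qed.

Lemma measurable_pair_deviation :
  measurable_fun setT (fun gg : G * G => pair_deviation gg.1 gg.2).
Proof.
apply: (@measurable_integral_r _ _ _ _ _ P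
  (fun (gg : G * G) z => (loss_deviation lam L z gg.1 gg.2)%:E)).
- apply/measurable_EFinP; apply: measurable_loss_deviation => //;
    exact: measurableT_comp.
- by move=> gg z; rewrite lee_fin loss_deviation_ge0.
Qed.

(** With x = lam (L(z,g) - L(z,g')), the pointwise bound x^2 <= 2 (1 + x)^2 + 2 is (x + 2)^2 >=
    0. *)
Lemma V_le_pair_deviation g g' :
  (lam ^+ 2)%:E * V P L g g' <= 4%:E * pair_deviation g g' + 2%:E.
Proof.
have md : measurable_fun setT (fun z => loss_deviation lam L z g g').
  exact: measurable_loss_deviation.
rewrite VE -ge0_integralZl//; last 3 first.
- by apply/measurable_EFinP; apply: measurable_funX; exact: mdiff.
- by move=> z _; rewrite lee_fin sqr_ge0.
- by rewrite lee_fin sqr_ge0.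
rewrite -ge0_integralZl//; last 2 first.
- exact/measurable_EFinP.
- by move=> z _; rewrite lee_fin loss_deviation_ge0.
rewrite -[2%:E](integral_prob_cst P) -ge0_integralD//; last 2 first.
- by move=> z _; rewrite mule_ge0// lee_fin loss_deviation_ge0.
- by apply: emeasurable_funM => //; exact/measurable_EFinP.
apply: ge0_le_integral => //.
- by move=> z _; rewrite mule_ge0 ?lee_fin ?sqr_ge0.
- apply: emeasurable_funM => //; apply/measurable_EFinP.
  by apply: measurable_funX; exact: mdiff.
- apply: emeasurable_funD => //; apply: emeasurable_funM => //.
  exact/measurable_EFinP.
move=> z _; rewrite -!EFinM -EFinD lee_fin loss_deviationE.
have := sqr_ge0 (lam * (L z g - L z g') + 2)%R; nra.
Qed.

Hypothesis risk_defined : forall g, quasi_integrable P (fun z => (L z g)%:E).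

(** A square-integrable difference of losses is integrable, and [e] is its mean. The two risks are
    thus finite together or equal to the same infinity. *)
Lemma risk_diff g g' : V P L g g' < +oo -> exists e : R,
  [/\ risk P L g = risk P L g' + e%:E, (`|e| <= 1 + fine (V P L g g'))%R &
    pair_deviation g g' =
      (1 / 2 + lam * e + lam ^+ 2 / 2 * fine (V P L g g'))%:E].
Proof.
move=> Vfin; pose e z := (L z g - L z g')%R.
have me : measurable_fun setT e by exact: mdiff.
have me2 : measurable_fun setT (fun z => (e z ^+ 2)%R).
  exact: measurable_funX.
have Vf : V P L g g' \is a fin_num by rewrite ge0_fin_numE ?V_ge0.
have ie2 : P.-integrable setT (fun z => (e z ^+ 2)%:E).
  apply/integrableP; split; first exact/measurable_EFinP.
  under eq_integral do rewrite gee0_abs ?lee_fin ?sqr_ge0//.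
  by rewrite -VE.
have i12 := integrableD measurableT
  (finite_measure_integrable_cst P 1%R measurableT) ie2.
have ie : P.-integrable setT (EFin \o e).
  apply: le_integrable i12 => //; first exact/measurable_EFinP.
  move=> z _ /=; rewrite lee_fin [leRHS]ger0_norm ?addr_ge0 ?sqr_ge0//.
  exact: norm_le1Dsqr.
have efin : \int[P]_z (e z)%:E \is a fin_num by exact: integrable_fin_num ie.
exists (fine (\int[P]_z (e z)%:E)); rewrite fineK//; split.
- rewrite !riskE -integralD_quasi//; last exact: risk_defined.
  by apply: eq_integral => z _; rewrite /e addrC subrK.
- rewrite -lee_fin EFinD -[(`|_|)%:E]/(`|(fine _)%:E|) !fineK// VE.
  apply: (le_trans (le_abse_integral _ _ _)) => //.
    exact/measurable_EFinP.
  rewrite -[1](integral_prob_cst P) -ge0_integralD//; last 2 first.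
  - by move=> z _; rewrite lee_fin sqr_ge0.
  - exact/measurable_EFinP.
  apply: ge0_le_integral => //.
  - by apply: measurableT_comp => //; exact/measurable_EFinP.
  - by apply: emeasurable_funD => //; exact/measurable_EFinP.
  - by move=> z _; rewrite lee_fin norm_le1Dsqr.
- rewrite /pair_deviation !EFinD !EFinM !fineK// VE.
  rewrite -(integral_affine2 _ _ _ ie ie2).
  by apply: eq_integral => z _; rewrite loss_deviationE.
Qed.

End risk_theory.
(** * The oracle inequality *)

Lemma ae_exists d (T : measurableType d) (R : realType) (Q : probability T R)
  (A : T -> Prop) : {ae Q, forall x, A x} -> exists x, A x.
Proof.
move=> [N [mN N0 sub]]; apply: contrapT => /forallNP nA.
have NT : N = setT by apply/seteqP; split => // x _;
  apply: sub; exact: nA.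
by move: N0; rewrite NT probability_setT => /eqP; rewrite onee_eq0.
Qed.

Section oracle.
Context dZ dG (Z : measurableType dZ) (G : measurableType dG) (R : realType).
Variables (lam : R) (L : Z -> G -> R) (P : probability Z R)
  (mub : probability G R).
Implicit Type rho : probability G R.
Hypothesis lam_gt0 : (0 < lam)%R.
Hypothesis mL : measurable_fun setT (fun zg : Z * G => L zg.1 zg.2).
Hypothesis risk_defined : forall g, quasi_integrable P (fun z => (L z g)%:E).

Local Notation r := (risk P L).
Local Notation Vr := (V P L).

Let mr := measurable_risk P mL.
Let mV := measurable_V P mL.
Let V0 := V_ge0 L P.

Let mV1 g : measurable_fun setT (Vr g).
Proof. exact: (measurableT_comp mV (measurable_pair1 g)). Qed.

Lemma V_sym g g' : Vr g g' = Vr g' g.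
Proof. by rewrite !VE; apply: eq_integral => z _; rewrite -sqrrN opprB. Qed.

Definition mean_V rho : \bar R := \int[rho]_g \int[mub]_g' Vr g g'.

Lemma mean_V_ge0 rho : 0 <= mean_V rho.
Proof. by apply: integral_ge0 => g _; exact: integral_ge0. Qed.

Definition oracle_deviation g : \bar R :=
  \int[mub]_g' pair_deviation lam L P g g'.

Let pd0 := pair_deviation_ge0 lam L P.

Let mpd := measurable_pair_deviation lam P mL.

Lemma oracle_deviation_ge0 g : 0 <= oracle_deviation g.
Proof. exact: integral_ge0. Qed.

Lemma measurable_oracle_deviation : measurable_fun setT oracle_deviation.
Proof. exact: (measurable_integral_r mub mpd pd0). Qed.

(** After this exchange the integrand no longer depends on [rho], as the Gibbs variational principle
    requires. *)
Lemma integral_mean_deviation rho :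
  \int[mub]_g' mean_deviation lam L rho P g' =
  \int[rho]_g oracle_deviation g.
Proof.
rewrite /oracle_deviation -(integral_swap mub rho (F := fun g' g =>
  pair_deviation lam L P g g')); last 2 first.
- exact: (measurable_fun_uncurry mpd measurable_snd measurable_fst).
- by move=> g' g; exact: pd0.
apply: eq_integral => g' _.
apply: (integral_swap P rho (F := fun z g => (loss_deviation lam L z g g')%:E)).
- by apply/measurable_EFinP; exact: measurable_loss_deviation.
- by move=> z g; rewrite lee_fin loss_deviation_ge0.
Qed.

(** Needed for the Gibbs minimizer, of which only the mean deviation is known to be finite. *)
Lemma mean_V_lty rho : \int[rho]_g oracle_deviation g < +oo ->
  mean_V rho < +oo.
Proof.
move=> odfin.
have mod := measurable_oracle_deviation; have od0 := oracle_deviation_ge0.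
have mpd1 g : measurable_fun setT (pair_deviation lam L P g).
  exact: (measurableT_comp mpd (measurable_pair1 g)).
have miV := measurable_integral_r mub mV V0.
have iV0 g : 0 <= \int[mub]_g' Vr g g' by exact: integral_ge0.
have lam2 : 0 <= (lam ^+ 2)%:E by rewrite lee_fin sqr_ge0.
have bnd g : (lam ^+ 2)%:E * \int[mub]_g' Vr g g' <=
    4%:E * oracle_deviation g + 2%:E.
  rewrite -ge0_integralZl// /oracle_deviation -ge0_integralZl//.
  rewrite -[2%:E](integral_prob_cst mub) -ge0_integralD//.
  - apply: ge0_le_integral => //.
    + by move=> g' _; rewrite mule_ge0.
    + exact: emeasurable_funM.
    + by apply: emeasurable_funD => //; exact: emeasurable_funM.
    + by move=> g' _; exact: V_le_pair_deviation.
  - by move=> g' _; rewrite mule_ge0.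
  - exact: emeasurable_funM.
have : (lam ^+ 2)%:E * mean_V rho <=
    4%:E * \int[rho]_g oracle_deviation g + 2%:E.
  rewrite /mean_V -ge0_integralZl// -ge0_integralZl//.
  rewrite -[2%:E](integral_prob_cst rho) -ge0_integralD//.
  - apply: ge0_le_integral => //.
    + by move=> g' _; rewrite mule_ge0.
    + exact: emeasurable_funM.
    + by apply: emeasurable_funD => //; exact: emeasurable_funM.
  - by move=> g' _; rewrite mule_ge0.
  - exact: emeasurable_funM.
have odf : \int[rho]_g oracle_deviation g \is a fin_num.
  by rewrite ge0_fin_numE// integral_ge0.
rewrite -(fineK odf) -EFinM -EFinD => H.
rewrite ltNge leye_eq; apply/negP => /eqP Vy.
by move: H; rewrite Vy gt0_muley// lte_fin exprn_gt0.
Qed.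

Let integrable_integral_V rho : mean_V rho < +oo ->
  rho.-integrable setT (fun g => \int[mub]_g' Vr g g').
Proof.
move=> qfin; apply/integrableP; split.
  exact: (measurable_integral_r mub mV V0).
by under eq_integral do rewrite gee0_abs ?integral_ge0//.
Qed.

Let integrable_V1 g (nu : probability G R) :
  \int[nu]_g' Vr g g' \is a fin_num ->
  nu.-integrable setT (Vr g).
Proof.
move=> fin; apply/integrableP; split => //.
under eq_integral do rewrite gee0_abs//.
by rewrite -ge0_fin_numE// integral_ge0.
Qed.

Lemma mean_V_ae rho : mean_V rho < +oo ->
  {ae rho, forall g, \int[mub]_g' Vr g g' \is a fin_num}.
Proof.
move=> /integrable_integral_V/(integrable_ae measurableT).
by apply: filterS => g /(_ Logic.I).
Qed.

Lemma mean_V_ae_mub rho : mean_V rho < +oo ->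
  {ae mub, forall g, \int[rho]_g' Vr g g' \is a fin_num}.
Proof.
rewrite /mean_V (integral_swap rho mub mV V0) => qfin.
have : mub.-integrable setT (fun g => \int[rho]_g' Vr g g').
  apply/integrableP; split; first exact: (measurable_integral_r rho mV V0).
  under eq_integral do rewrite gee0_abs ?integral_ge0//.
  by under eq_integral do under eq_integral do rewrite V_sym.
move/(integrable_ae measurableT).
by apply: filterS => g /(_ Logic.I).
Qed.

Lemma V_ae g (nu : probability G R) : \int[nu]_g' Vr g g' \is a fin_num ->
  {ae nu, forall g', Vr g' g < +oo}.
Proof.
move=> /integrable_V1/(integrable_ae measurableT).
by apply: filterS => g' /(_ Logic.I); rewrite V_sym ge0_fin_numE.
Qed.

(** One function [g] of finite risk serves as anchor: [risk_diff] dominates the risk at [g'] by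
    [|r g| + 1 + Vr g g']. *)
Lemma risk_integrable (nu : probability G R) g : r g \is a fin_num ->
  \int[nu]_g' Vr g g' \is a fin_num -> nu.-integrable setT r.
Proof.
move=> rfin Vfin.
have iB := integrableD measurableT (finite_measure_integrable_cst nu
  (`|fine (r g)| + 1)%R measurableT) (integrable_V1 Vfin).
apply: le_integrable iB => // g' _ /=.
rewrite [leRHS]gee0_abs; last by rewrite adde_ge0// lee_fin addr_ge0.
have [Vy|Vy] := eqVneq (Vr g g') +oo; first by rewrite Vy addey ?leey.
have [|e [-> e1 _]] := risk_diff lam mL risk_defined (g := g') (g' := g).
  by rewrite V_sym ltey.
rewrite -(fineK rfin) -[Vr g g']fineK; last by rewrite ge0_fin_numE// ltey.
rewrite -EFinD -EFinD/= lee_fin (le_trans (ler_normD _ _))//.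
by rewrite -addrA lerD2l V_sym.
Qed.

(** The anchor [g1], typical for [mub], ties its risk to that of [rho]-almost every [g], and [+oo]
    is excluded by hypothesis. A second anchor [g0], typical for [rho], carries the conclusion back
    to [mub]. *)
Lemma risk_dichotomy rho : mean_V rho < +oo -> \int[rho]_g r g < +oo ->
  mub.-integrable setT r \/
  ({ae mub, forall g, r g = -oo} /\ \int[rho]_g r g = -oo).
Proof.
move=> qfin rfin; have A1 := mean_V_ae qfin.
have [g1 V1] := ae_exists (mean_V_ae_mub qfin).
have {V1}R1 : {ae rho, forall g, exists e, r g = r g1 + e%:E}.
  apply: filterS (V_ae V1) => g /(risk_diff lam mL risk_defined).
  by move=> [e [-> _ _]]; exists e.
case E1 : (r g1) R1 => [x||] R1.
- left; have [g0 [V0fin [e r0]]] := ae_exists (filterI A1 R1).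
  by apply: (@risk_integrable _ g0) => //; rewrite r0.
- move: rfin; rewrite (_ : \int[rho]_g r g = \int[rho]_g (cst +oo) g).
    by rewrite integral_prob_cst ltxx.
  by apply: ae_eq_integral => //; apply: filterS R1 => g [e ->] _.
- right; split; last first.
    rewrite (_ : \int[rho]_g r g = \int[rho]_g (cst -oo) g).
      by rewrite integral_prob_cst.
    by apply: ae_eq_integral => //; apply: filterS R1 => g [e ->] _.
  have [g0 [V0fin [e r0]]] := ae_exists (filterI A1 R1).
  apply: filterS (V_ae V0fin) => g /(risk_diff lam mL risk_defined).
  by move=> [e' [-> _ _]]; rewrite r0.
Qed.

(** Integrability under [rho] comes first, from an anchor typical for [mub]; only then may the mean
    of a difference of risks be split. *)
Lemma oracle_identity rho : mub.-integrable setT r -> mean_V rho < +oo ->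
  rho.-integrable setT r /\
  \int[rho]_g oracle_deviation g =
    (1 / 2 - lam * fine (\int[mub]_g r g))%:E + lam%:E * \int[rho]_g r g +
    (lam ^+ 2 / 2)%:E * mean_V rho.
Proof.
move=> ri qfin; set rb := fine _.
have rbE : \int[mub]_g r g = rb%:E.
  by rewrite fineK//; exact: integrable_fin_num ri.
have rae : {ae mub, forall g, r g \is a fin_num}.
  by apply: filterS (integrable_ae measurableT ri) => g /(_ Logic.I).
have [g1 [V1 r1]] := ae_exists (filterI (mean_V_ae_mub qfin) rae).
have rhoi := risk_integrable r1 V1.
split => //.
rewrite /mean_V -integral_affine2//; last exact: integrable_integral_V.
apply: ae_eq_integral => //.
- exact: measurable_oracle_deviation.
- have miV := measurable_integral_r mub mV V0.
  apply: emeasurable_funD; last exact: emeasurable_funM.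
  by apply: emeasurable_funD => //; exact: emeasurable_funM.
apply: filterS (filterI (integrable_ae measurableT rhoi) (mean_V_ae qfin)).
move=> g [/(_ Logic.I) rg Vg] _.
(* For fixed [g], this presents the right-hand side as the [mub]-integral of a function affine in
   [r g'] and [Vr g g']. *)
have -> : (1 / 2 - lam * rb)%:E + lam%:E * r g +
    (lam ^+ 2 / 2)%:E * \int[mub]_g' Vr g g' =
    (1 / 2 + lam * fine (r g))%:E + (- lam)%:E * \int[mub]_g' r g' +
    (lam ^+ 2 / 2)%:E * \int[mub]_g' Vr g g'.
  rewrite rbE -{1}(fineK rg) -!EFinM -!EFinD; congr (_%:E + _); ring.
rewrite -integral_affine2//; last exact: integrable_V1.
apply: ae_eq_integral => //.
- exact: (measurableT_comp mpd (measurable_pair1 g)).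
- apply: emeasurable_funD; last exact: emeasurable_funM.
  by apply: emeasurable_funD => //; exact: emeasurable_funM.
apply: filterS (filterI rae (V_ae Vg)) => g' [rg' Vg'] _.
have Vgf : Vr g g' \is a fin_num by rewrite ge0_fin_numE// V_sym.
have [|e [re _ ->]] := risk_diff lam mL risk_defined (g := g) (g' := g').
  by rewrite V_sym.
have -> : e = (fine (r g) - fine (r g'))%R.
  by rewrite re -(fineK rg') -EFinD/= addrC addKr.
rewrite -{2}(fineK rg') -{2}(fineK Vgf) -!EFinM -!EFinD; congr EFin; ring.
Qed.

End oracle.
(** [-oo + +oo] evaluates to [-oo], so without definedness a sum below [+oo] could hide an infinite
    term. *)
Lemma adde_lty3 (R : realDomainType) (a b c : \bar R) :
    0 <= b -> 0 <= c -> a +? b -> a + b +? c -> a + b + c < +oo ->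
  [/\ a < +oo, b < +oo & c < +oo].
Proof.
by case: a => [a||]; case: b => [b||]; case: c => [c||]; rewrite ?ltry.
Qed.

(** * The right-hand side as an affine function of the Gibbs objective *)

Section oracle_value.
Context dZ dG (Z : measurableType dZ) (G : measurableType dG) (R : realType).
Variables (lam : R) (L : Z -> G -> R) (P : probability Z R)
  (pi mub : probability G R) (n : nat).
Implicit Type rho : probability G R.
Hypothesis lam_gt0 : (0 < lam)%R.
Hypothesis mL : measurable_fun setT (fun zg : Z * G => L zg.1 zg.2).
Hypothesis risk_defined : forall g, quasi_integrable P (fun z => (L z g)%:E).

Local Notation r := (risk P L).
Local Notation od := (oracle_deviation lam L P mub).

Definition oracle_objective rho : \bar R :=
  n.+1%:R%:E * \int[rho]_g od g + KL rho pi.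

Let c : R := (lam * n.+1%:R)^-1.

Let c_gt0 : (0 < c)%R.
Proof. by rewrite invr_gt0 mulr_gt0. Qed.

(** As [c * n.+1%:R = lam^-1], the constant [1 / 2 - lam * rb] of [oracle_identity] becomes
    [(2 * lam)^-1 - rb]. *)
Lemma oracle_value rho : mub.-integrable setT r -> mean_V L P mub rho < +oo ->
  \int[rho]_g r g + (lam / 2)%:E * mean_V L P mub rho + c%:E * KL rho pi =
  (fine (\int[mub]_g r g) - (2 * lam)^-1)%:E + c%:E * oracle_objective rho.
Proof.
move=> ri qfin; set rb := fine _.
have [rhoi odE] := oracle_identity lam mL risk_defined ri qfin.
have rfin : \int[rho]_g r g \is a fin_num by exact: integrable_fin_num rhoi.
have qf : mean_V L P mub rho \is a fin_num by rewrite ge0_fin_numE// mean_V_ge0.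
rewrite /oracle_objective odE -/rb; have := KL_ge0 pi rho.
rewrite -(fineK rfin) -(fineK qf) -!EFinM -!EFinD.
case: (KL rho pi) => [k _|_|//]; last first.
  by rewrite gt0_muley ?lte_fin// !addey// gt0_muley ?lte_fin// addey.
rewrite -(EFinD _ k) -!EFinM -!EFinD; congr EFin; rewrite /c.
have : (n.+1%:R != 0 :> R)%R by rewrite pnatr_eq0.
by move: n.+1%:R%R => N N0; field; rewrite N0 gt_eqF.
Qed.

(** The given [rho] shows that the partition function is positive: otherwise [od] would be infinite
    [pi]-a.e., hence [rho]-a.e. by domination. *)
Lemma oracle_objective_min rho : \int[rho]_g od g < +oo -> KL rho pi < +oo ->
  exists rho0, [/\ \int[rho0]_g od g < +oo, KL rho0 pi < +oo &
    forall rho', oracle_objective rho0 <= oracle_objective rho'].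
Proof.
move=> odfin KLfin.
have mod := measurable_oracle_deviation lam P mub mL.
have od0 := oracle_deviation_ge0 lam L P mub.
pose h g := n.+1%:R%:E * od g.
have mh : measurable_fun setT h by exact: emeasurable_funM.
have h0 g : 0 <= h g by rewrite mule_ge0.
have hE rho' : \int[rho']_g h g = n.+1%:R%:E * \int[rho']_g od g.
  by rewrite ge0_integralZl.
have W0 : (0 < partition_fun pi h)%R.
  have mb : measurable_fun setT (fun g => (boltzmann h g)%:E).
    by apply/measurable_EFinP; exact: measurable_boltzmann.
  rewrite lt_neqAle fine_ge0 ?andbT; last first.
    by apply: integral_ge0 => g _; rewrite lee_fin boltzmann_ge0.
  apply/eqP => W0.
  have : \int[pi]_g `|(boltzmann h g)%:E| = 0.
    under eq_integral do rewrite gee0_abs ?lee_fin ?boltzmann_ge0//.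
    by rewrite -partition_funE// -W0.
  move/(ae_eq_integral_abs pi measurableT mb) => b0.
  have rhopi : rho `<< pi.
    by apply: contrapT => nrhopi; move: KLfin; rewrite /KL asboolF.
  have odae : {ae rho, forall g, od g \is a fin_num}.
    have : rho.-integrable setT od.
      apply/integrableP; split => //.
      by under eq_integral do rewrite gee0_abs//.
    by move/(integrable_ae measurableT); apply: filterS => g /(_ Logic.I).
  have [g [bg odg]] := ae_exists
    (filterI (null_dominates_ae_eq measurableT rhopi b0) odae).
  have := bg Logic.I; rewrite /boltzmann /h -(fineK odg) -EFinM => -[] /eqP.
  by rewrite expR_eq0.
have [rho0 [h_fin KL_fin hKL]] := donsker_varadhan_eq mh h0 W0.
exists rho0; split.
- rewrite ltNge leye_eq; apply/negP => /eqP oy.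
  by move: h_fin; rewrite hE oy gt0_muley ?lte_fin// ltxx.
- by rewrite -ge0_fin_numE// KL_ge0.
- move=> rho'; rewrite /oracle_objective -!hE hKL.
  exact: donsker_varadhan.
Qed.

End oracle_value.

(** The minimum ranges over the [rho] for which the right-hand side has a meaning, and is stated as
    an infimum that is attained as soon as such a [rho] exists. *)
Theorem theorem6p1 (R : realType)
    (dX dY dG dO : measure_display)
    (X : measurableType dX) (Y : measurableType dY)
    (G : measurableType dG) (predict : G -> {mfun X >-> Y})
    (predict_inj : injective predict)
    (L : (X * Y)%type -> G -> R)
    (mL : measurable_fun [set: (X * Y * G)%type] (fun zg => L zg.1 zg.2))
    (lam : R) (lam_gt0 : (0 < lam)%R)
    (pi : probability G R)
    (P : probability (X * Y)%type R)
    (n : nat)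
    (Omega : measurableType dO) (Pr : probability Omega R)
    (Z : 'I_n -> {RV Pr >-> (X * Y)%type}) (iidZ : iid P Z)
    (risk_defined : forall g, quasi_integrable P (fun z => (L z g)%:E)) :
  let mu_hat (w : Omega) := seqrand_law lam L pi [tuple Z i w | i < n] in
  let ER (rho : probability G R) := \int[rho]_g risk P L g in
  let EV (rho : probability G R) :=
    (lam / 2)%:E *
    \int[rho]_g \int[Pr]_w \int[mu_hat w]_g' V P L g g' in
  let EK (rho : probability G R) := ((lam * n.+1%:R)^-1)%:E * KL rho pi in
  let bounds := [set ER rho + EV rho + EK rho | rho in
    [set rho : probability G R | [/\ quasi_integrable rho (risk P L),
      ER rho +? EV rho & ER rho + EV rho +? EK rho]]] in
  \int[Pr]_w \int[mu_hat w]_g' risk P L g' <= ereal_inf bounds /\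
  (bounds !=set0 -> bounds (ereal_inf bounds)).
Proof.
move=> mu_hat ER EV EK bounds.
have [k [mub [kE mubE regret]]] := seqrand_mixture pi lam_gt0 mL iidZ.
have mu_hatE w f : \int[mu_hat w]_g f g = \int[k w]_g f g.
  by apply/esym/eq_integral_set_fun => A mA; exact: kE.
have mr := measurable_risk P mL.
have mV := measurable_V P mL.
have LHSE : \int[Pr]_w \int[mu_hat w]_g' risk P L g' =
    \int[Pr]_w \int[k w]_g' risk P L g'.
  by apply: eq_integral => w _; exact: mu_hatE.
have EVE rho : EV rho = (lam / 2)%:E * mean_V L P mub rho.
  congr (_ * _); apply: eq_integral => g _.
  rewrite -mubE; last 2 first.
  - exact: (measurableT_comp mV (measurable_pair1 g)).
  - by move=> g'; exact: V_ge0.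
  by apply: eq_integral => w _; exact: mu_hatE.
have EV0 rho : 0 <= EV rho.
  by rewrite EVE mule_ge0 ?mean_V_ge0// lee_fin divr_ge0// ltW.
pose c : R := ((lam * n.+1%:R)^-1)%R.
have c_gt0 : (0 < c)%R by rewrite invr_gt0 mulr_gt0.
have EK0 rho : 0 <= EK rho by rewrite mule_ge0 ?KL_ge0// lee_fin ltW.
have fin_of_lty rho : ER rho +? EV rho -> ER rho + EV rho +? EK rho ->
    ER rho + EV rho + EK rho < +oo ->
    [/\ mean_V L P mub rho < +oo, ER rho < +oo & KL rho pi < +oo].
  move=> d1 d2 /(adde_lty3 (EV0 rho) (EK0 rho) d1 d2)[ERfin EVfin EKfin].
  split => //; rewrite ltNge leye_eq; apply/negP => /eqP y.
  - by move: EVfin; rewrite EVE y gt0_muley ?ltxx// lte_fin divr_gt0.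
  - by move: EKfin; rewrite /EK y gt0_muley ?ltxx// lte_fin.
(* In the second case both sides of the bound are [-oo], and [rho] attains the infimum. *)
have dichotomy rho : ER rho +? EV rho -> ER rho + EV rho +? EK rho ->
    ER rho + EV rho + EK rho < +oo ->
    mub.-integrable setT (risk P L) \/
    (\int[Pr]_w \int[mu_hat w]_g' risk P L g' = -oo /\
     ER rho + EV rho + EK rho = -oo).
  move=> d1 d2 Jfin; have [qfin rfin KLfin] := fin_of_lty rho d1 d2 Jfin.
  have [ri|[rNy rhoNy]] := risk_dichotomy lam mL risk_defined qfin rfin.
    by left.
  right; split; first by rewrite LHSE (integral_mixtureNy mubE mr rNy).
  have -> : ER rho = -oo by [].
  have KLf : KL rho pi \is a fin_num by rewrite ge0_fin_numE ?KL_ge0.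
  have qf : mean_V L P mub rho \is a fin_num.
    by rewrite ge0_fin_numE// mean_V_ge0.
  by rewrite EVE /EK -(fineK KLf) -(fineK qf).
have valE rho : mub.-integrable setT (risk P L) -> mean_V L P mub rho < +oo ->
    ER rho + EV rho + EK rho =
    (fine (\int[mub]_g risk P L g) - (2 * lam)^-1)%:E +
    c%:E * oracle_objective lam L P pi mub n rho.
  by move=> ri qfin; rewrite EVE; exact: oracle_value.
have lower rho : ER rho +? EV rho -> ER rho + EV rho +? EK rho ->
    \int[Pr]_w \int[mu_hat w]_g' risk P L g' <= ER rho + EV rho + EK rho.
  move=> d1 d2; have [->|Jy] := eqVneq (ER rho + EV rho + EK rho) +oo.
    by rewrite leey.
  have Jfin : ER rho + EV rho + EK rho < +oo by rewrite ltey.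
  have [qfin rfin KLfin] := fin_of_lty rho d1 d2 Jfin.
  have [ri|[-> _]] := dichotomy rho d1 d2 Jfin; last by rewrite leNye.
  rewrite valE// LHSE (integral_mixture mubE ri).
  have rfin' : \int[mub]_g risk P L g \is a fin_num.
    exact: integrable_fin_num ri.
  have := regret rho; rewrite integral_mean_deviation//.
  rewrite -/(oracle_objective lam L P pi mub n rho).
  rewrite -(fineK rfin'); set rb := fine _.
  case: (oracle_objective _ _ _ _ _ _ _) => [s| |//].
    rewrite lee_fin => ho.
    rewrite -EFinM -EFinD lee_fin.
    (* Scaled by [c], the gains of the regret bound become [(2 * lam)^-1], the constant subtracted
       in [valE]. *)
    have : (c * (n.+1%:R / 2) <= c * s)%R by rewrite ler_pM2l.
    have -> : (c * (n.+1%:R / 2) = (2 * lam)^-1)%R.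
      have : (n.+1%:R != 0 :> R)%R by rewrite pnatr_eq0.
      by rewrite /c; move: n.+1%:R%R => N N0; field; rewrite N0 gt_eqF.
    by rewrite -addrA lerDl addrC subr_ge0.
  by rewrite gt0_muley ?lte_fin// addey ?leey.
split.
  by apply: le_ereal_inf_tmp => _ [rho [_ d1 d2] <-]; exact: lower.
move=> [x0 [rho1 adm1 Jx0]].
have attained (rho : probability G R) : [/\ quasi_integrable rho (risk P L),
      ER rho +? EV rho & ER rho + EV rho +? EK rho] ->
    (forall rho' : probability G R, [/\ quasi_integrable rho' (risk P L),
      ER rho' +? EV rho' & ER rho' + EV rho' +? EK rho'] ->
      ER rho + EV rho + EK rho <= ER rho' + EV rho' + EK rho') ->
    bounds (ereal_inf bounds).
  move=> adm lb; exists rho => //; apply/eqP; rewrite eq_le; apply/andP; split.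
    by apply: le_ereal_inf_tmp => _ [rho' adm' <-]; exact: lb.
  by apply: ereal_inf_lbound; exists rho.
(* If every admissible value is [+oo], any admissible law attains the infimum. *)
have [[rho0 [[q0 d1 d2] Jfin]]|ninf] := pselect (exists rho : probability G R,
    [/\ quasi_integrable rho (risk P L),
      ER rho +? EV rho & ER rho + EV rho +? EK rho] /\
    ER rho + EV rho + EK rho < +oo); last first.
  apply: (attained rho1) => // rho' adm'.
  rewrite leNgt; apply/negP => J'; apply: ninf; exists rho'; split => //.
  exact: lt_le_trans J' (leey _).
have [qfin rfin KLfin] := fin_of_lty rho0 d1 d2 Jfin.
have [ri|[_ JNy]] := dichotomy rho0 d1 d2 Jfin; last first.
  by apply: (attained rho0) => // rho' _; rewrite JNy leNye.
have [rho0i odE] := oracle_identity lam mL risk_defined ri qfin.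
(* The minimizer [rhos] ranges over all laws, so it remains to check that it is admissible. *)
have [rhos [sod sKL smin]] : exists rhos : probability G R, [/\
    \int[rhos]_g oracle_deviation lam L P mub g < +oo, KL rhos pi < +oo &
    forall rho', oracle_objective lam L P pi mub n rhos <=
      oracle_objective lam L P pi mub n rho'].
  apply: oracle_objective_min KLfin => //.
  have r0f := integrable_fin_num measurableT rho0i.
  have q0f : mean_V L P mub rho0 \is a fin_num.
    by rewrite ge0_fin_numE ?mean_V_ge0.
  by rewrite odE -(fineK r0f) -(fineK q0f) -!EFinM -!EFinD ltry.
have sq : mean_V L P mub rhos < +oo by exact: (mean_V_lty lam_gt0 mL).
have [rhosi _] := oracle_identity lam mL risk_defined ri sq.
have ERf : ER rhos \is a fin_num by exact: integrable_fin_num rhosi.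
have EVf : EV rhos \is a fin_num.
  by rewrite EVE fin_numM// ge0_fin_numE ?mean_V_ge0.
apply: (attained rhos).
  split.
  - by left; exact: integral_funepos_lt_pinfty rhosi.
  - exact: fin_num_adde_defr.
  - by rewrite fin_num_adde_defr// fin_numD ERf.
move=> rho' [_ d1' d2'].
have [->|Jy] := eqVneq (ER rho' + EV rho' + EK rho') +oo; first by rewrite leey.
have [q' _ _] :
    [/\ mean_V L P mub rho' < +oo, ER rho' < +oo & KL rho' pi < +oo].
  by apply: fin_of_lty; rewrite // ltey.
rewrite !valE// leeD2l//.
by apply: lee_wpmul2l; rewrite // lee_fin ltW.
Qed.
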